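(* Let $r_t, S_t, x_t, I_t, \pi_t$ ($t\ge 0$) be the five-factor model $$dr_t=\kappa(\bar r-r_t)dt+\sigma_r dW^r_t,\quad \frac{dS_t}{S_t}=(r_t+x_t)dt+\sigma_S dW^S_t,\quad dx_t=\alpha(\bar x-x_t)dt-\sigma_x dW^S_t,$$ $$\frac{dI_t}{I_t}=\pi_t dt+\sigma_I dW^I_t,\quad d\pi_t=\beta(\bar\pi-\pi_t)dt+\sigma_\pi dW^\pi_t,$$ where $(W^r_t,W^S_t,W^\pi_t)'$ is a vector Brownian motion with unit variance and correlation matrix $$\rho=\begin{pmatrix}1&\rho_{rS}&\rho_{r\pi}\\ \rho_{rS}&1&\rho_{S\pi}\\ \rho_{r\pi}&\rho_{S\pi}&1\end{pmatrix}.$$ For $t\ge 0$ let $$Y_t=\Big(r_t,\int_0^t r_sds,\;x_t,\int_0^t x_sds,\;\pi_t,\int_0^t\pi_sds,\;W^S_t\Big)'.$$ Then the conditional distribution of $Y_t$ given the initial conditions $(r_0,S_0,x_0,I_0,\pi_0)$ is the (possibly degenerate) seven-dimensional normal distribution $N_7(m,\Sigma(t))$ with mean vector $$m=\begin{pmatrix}\bar r+e^{-\kappa t}(r_0-\bar r)\\ t\bar r+\Psi(\kappa,t)(r_0-\bar r)\\ \bar x+e^{-\alpha t}(x_0-\bar x)\\ t\bar x+\Psi(\alpha,t)(x_0-\bar x)\\ \bar\pi+e^{-\beta t}(\pi_0-\bar\pi)\\ t\bar\pi+\Psi(\beta,t)(\pi_0-\bar\pi)\\ 0\end{pmatrix}$$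 and symmetric variance-covariance matrix $\Sigma(t)=(\Sigma_{ij})$ whose entries on and below the diagonal are - $\Sigma_{11}=\sigma_r^2\Psi(2\kappa,t)$; - $\Sigma_{21}=\sigma_r^2\Gamma(\kappa,\kappa,t)$, $\Sigma_{22}=\sigma_r^2\Upsilon(\kappa,t)$; - $\Sigma_{31}=-\sigma_r\sigma_x\rho_{rS}\Psi(\kappa+\alpha,t)$, $\Sigma_{32}=-\sigma_r\sigma_x\rho_{rS}\Gamma(\kappa,\alpha,t)$, $\Sigma_{33}=\sigma_x^2\Psi(2\alpha,t)$; - $\Sigma_{41}=-\sigma_r\sigma_x\rho_{rS}\Gamma(\alpha,\kappa,t)$, $\Sigma_{42}=-\sigma_r\sigma_x\rho_{rS}\Lambda(\kappa,\alpha,t)$, $\Sigma_{43}=\sigma_x^2\Gamma(\alpha,\alpha,t)$, $\Sigma_{44}=\sigma_x^2\Upsilon(\alpha,t)$; - $\Sigma_{51}=\sigma_r\sigma_\pi\rho_{r\pi}\Psi(\kappa+\beta,t)$, $\Sigma_{52}=\sigma_r\sigma_\pi\rho_{r\pi}\Gamma(\kappa,\beta,t)$, $\Sigma_{53}=-\sigma_x\sigma_\pi\rho_{S\pi}\Psi(\alpha+\beta,t)$, $\Sigma_{54}=-\sigma_x\sigma_\pi\rho_{S\pi}\Gamma(\alpha,\beta,t)$, $\Sigma_{55}=\sigma_\pi^2\Psi(2\beta,t)$; - $\Sigma_{61}=\sigma_r\sigma_\pi\rho_{r\pi}\Gamma(\beta,\kappa,t)$, $\Sigma_{62}=\sigma_r\sigma_\pi\rho_{r\pi}\Lambda(\kappa,\beta,t)$,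 $\Sigma_{63}=-\sigma_x\sigma_\pi\rho_{S\pi}\Gamma(\beta,\alpha,t)$, $\Sigma_{64}=-\sigma_x\sigma_\pi\rho_{S\pi}\Lambda(\alpha,\beta,t)$, $\Sigma_{65}=\sigma_\pi^2\Gamma(\beta,\beta,t)$, $\Sigma_{66}=\sigma_\pi^2\Upsilon(\beta,t)$; - $\Sigma_{71}=\sigma_r\rho_{rS}\Psi(\kappa,t)$, $\Sigma_{72}=\sigma_r\rho_{rS}\Theta(\kappa,t)$, $\Sigma_{73}=-\sigma_x\Psi(\alpha,t)$, $\Sigma_{74}=-\sigma_x\Theta(\alpha,t)$, $\Sigma_{75}=\sigma_\pi\rho_{S\pi}\Psi(\beta,t)$, $\Sigma_{76}=\sigma_\pi\rho_{S\pi}\Theta(\beta,t)$, $\Sigma_{77}=t$.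
   Context: Parameters: $\kappa,\alpha,\beta,\bar r,\bar x,\bar\pi$ are real (vanishing mean reversion parameters $\kappa,\alpha,\beta$ are allowed) and the volatilities $\sigma_r,\sigma_S,\sigma_x,\sigma_I,\sigma_\pi\ge 0$ (zero allowed). $\rho$ is positive-semidefinite, possibly singular. The four standard Brownian motions $W^r,W^S,W^\pi,W^I$ start at $0$ and are jointly Gaussian, with $W^I$ independent of $(W^r,W^S,W^\pi)$. The initial values $(r_0,S_0,x_0,I_0,\pi_0)$ are given. A prime denotes transpose. Auxiliary functions (for real $\kappa,\alpha$ and $t\ge0$): $\Psi(\kappa,t)=\int_0^t e^{-\kappa u}du$, i.e. $t$ if $\kappa=0$ and $\frac1\kappa(1-e^{-\kappa t})$ if $\kappa\ne0$. $\Theta(\kappa,t)=\frac{t^2}{2}$ if $\kappa=0$, and $\frac1{\kappa^2}(-1+\kappa t+e^{-\kappa t})$ if $\kappa\neq0$. $\Upsilon(\kappa,t)=\frac{t^3}{3}$ if $\kappa=0$, and $\frac1{2\kappa^3}(-3+2\kappa t+4e^{-\kappa t}-e^{-2\kappa t})$ if $\kappa\ne0$. $\Gamma(\kappa,\alpha,t)=\frac{t^2}2$ if $\kappa=\alpha=0$; $\frac1{\alpha^2}(1-e^{-\alpha t}-\alpha te^{-\alpha t})$ if $\kappa=0,\alpha\ne0$; $\frac1\kappa(\Psi(\alpha,t)-\Psi(\alpha+\kappa,t))$ if $\kappa\neq0$. $\Lambda(\kappa,\alpha,t)=\frac{t^3}{3}$ if $\kappa=\alpha=0$; $\frac1{2\alpha^3}(-2+t^2\alpha^2+2e^{-\alpha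 t}+2\alpha te^{-\alpha t})$ if $\kappa=0,\alpha\neq0$; $\frac1{2\kappa^3}(-2+t^2\kappa^2+2e^{-\kappa t}+2\kappa te^{-\kappa t})$ if $\kappa\ne0,\alpha=0$; $\frac1{\alpha\kappa}(\Psi(\alpha+\kappa,t)-\Psi(\alpha,t)-\Psi(\kappa,t)+t)$ if $\kappa\neq0,\alpha\neq0$. *)

(* Defs.v *)
From HB Require Import structures.
From mathcomp Require Import all_boot all_order all_algebra.
From mathcomp Require Import all_classical all_reals all_analysis.

Set Implicit Arguments.
Unset Strict Implicit.
Unset Printing Implicit Defensive.

Import Order.TTheory GRing.Theory Num.Theory.
Import numFieldNormedType.Exports.

Local Open Scope classical_set_scope.
Local Open Scope ring_scope.

(* Random vectors take values in n.-tuple R, which the library equips with the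
   product (hence Borel) sigma-algebra. *)

(* The variance v may vanish, in which case the law is a Dirac mass; the case
   distinction is needed because the library's [normal_prob m 0] is the uniform
   law on [0, 1]. *)
Definition normal_law (R : realType) (mu : set R -> \bar R) (m v : R) : Prop :=
  0 <= v /\
  forall A : set R, measurable A ->
    mu A = if v == 0 then \d_m A else normal_prob m (Num.sqrt v) A.

(* Possibly degenerate N_n(m, S): every linear functional u is N(u m, u S u'). *)
Definition multinormal_law (R : realType) (n : nat)
    (mu : set (n.-tuple R) -> \bar R) (m : n.-tuple R) (S : 'M[R]_n) : Prop :=
  S^T = S /\
  forall u : 'rV[R]_n,
    normal_law (pushforward mu (fun x : n.-tuple R => \sum_i u 0 i * tnth x i))
      (\sum_i u 0 i * tnth m i) ((u *m S *m u^T) 0 0).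

Definition possemidef (R : realType) (n : nat) (S : 'M[R]_n) : Prop :=
  S^T = S /\ forall u : 'rV[R]_n, 0 <= (u *m S *m u^T) 0 0.

(* k is a regular conditional distribution of Y given X. *)
Definition conditional_distribution (d d1 d2 : measure_display)
    (T : measurableType d) (T1 : measurableType d1) (T2 : measurableType d2)
    (R : realType) (P : probability T R) (Y : T -> T2) (X : T -> T1)
    (k : R.-pker T1 ~> T2) : Prop :=
  [/\ measurable_fun setT X, measurable_fun setT Y &
   forall (A : set T1) (B : set T2), measurable A -> measurable B ->
     P (X @^-1` A `&` Y @^-1` B) =
       (\int[P]_(w in X @^-1` A) k (X w) B)%E].

Section processes.
Context (d : measure_display) (T : measurableType d) (R : realType).
Context (P : probability T R).

(* Processes and filtrations are indexed by R; only times t >= 0 matter. *)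
Definition filtration (F : R -> set (set T)) : Prop :=
  [/\ forall t, 0 <= t -> sigma_algebra setT (F t),
      forall t, 0 <= t -> F t `<=` measurable &
      forall s t, 0 <= s -> s <= t -> F s `<=` F t].

Definition adapted (F : R -> set (set T)) (d' : measure_display)
    (E : measurableType d') (X : R -> T -> E) : Prop :=
  forall t, 0 <= t -> preimage_set_system setT (X t) measurable `<=` F t.

Definition continuous_path (f : R -> R) : Prop :=
  {within `[0, +oo[, continuous f}.

Definition independent_systems (G H : set (set T)) : Prop :=
  forall A B, G A -> H B -> P (A `&` B) = (P A * P B)%E.

Definition process_sigma (d' : measure_display) (E : measurableType d')
    (X : R -> T -> E) : set (set T) :=
  <<s \bigcup_(t in [set t | 0 <= t]) preimage_set_system setT (X t) measurable >>.

Definition increment (n : nat) (W : R -> T -> n.-tuple R) (s t : R) (w : T)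
    : n.-tuple R :=
  [tuple tnth (W t w) i - tnth (W s w) i | i < n].

(* n-dimensional Brownian motion relative to F, started at 0, with covariance
   matrix C per unit of time. *)
Definition brownian_motion (F : R -> set (set T)) (n : nat) (C : 'M[R]_n)
    (W : R -> T -> n.-tuple R) : Prop :=
  [/\ adapted F W,
      {ae P, forall w, forall i, tnth (W 0 w) i = 0},
      {ae P, forall w, forall i, continuous_path (fun t => tnth (W t w) i)},
      forall s t, 0 <= s -> s <= t ->
        independent_systems (F s)
          (preimage_set_system setT (increment W s t) measurable) &
      forall s t, 0 <= s -> s <= t ->
        multinormal_law (pushforward P (increment W s t))
          [tuple 0 | _ < n] ((t - s) *: C)].

Definition gaussian_process (n : nat) (W : R -> T -> n.-tuple R) : Prop :=
  forall (k : nat) (s : 'I_k -> R) (c : 'I_k -> 'I_n -> R),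
    (forall j, 0 <= s j) ->
    exists m v : R,
      normal_law
        (pushforward P (fun w => \sum_j \sum_i c j i * tnth (W (s j) w) i)) m v.

(* Z is a version of the Ito integral of H against W over [0, t], for a
   continuous adapted integrand H: the left-point sums converge to Z in
   probability as the mesh of the partition of [0, t] tends to 0. *)
Definition ito_integral (H W : R -> T -> R) (t : R) (Z : T -> R) : Prop :=
  forall eps : R, 0 < eps -> exists2 delta : R, 0 < delta &
    forall (n : nat) (s : nat -> R), s 0%N = 0 -> s n = t ->
      (forall k, (k < n)%N -> s k <= s k.+1 /\ s k.+1 - s k < delta) ->
      (P [set w | (eps <=
           `| \sum_(0 <= k < n) H (s k) w * (W (s k.+1) w - W (s k) w) - Z w |)%R]
         <= eps%:E)%E.

(* X solves dX_t = a_t dt + b_t dW_t, i.e. X_t - X_0 - \int_0^t a_s ds is the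
   Ito integral of b over [0, t] for all t >= 0.  All paths of X are continuous,
   so that time integrals of solutions are random variables. *)
Definition sde_solution (F : R -> set (set T)) (X a b W : R -> T -> R) : Prop :=
  [/\ adapted F X, forall w, continuous_path (X ^~ w) &
      forall t, 0 <= t ->
        ito_integral b W t (fun w =>
          X t w - X 0 w - \int[lebesgue_measure]_(s in `[0, t]) a s w)].

End processes.

Section auxiliary_functions.
Context (R : realType).
Implicit Types kappa alpha t : R.

Definition Psi kappa t : R :=
  if kappa == 0 then t else kappa^-1 * (1 - expR (- (kappa * t))).

Definition Theta kappa t : R :=
  if kappa == 0 then t ^+ 2 / 2
  else (kappa ^+ 2)^-1 * (- 1 + kappa * t + expR (- (kappa * t))).

Definition Upsilon kappa t : R :=
  if kappa == 0 then t ^+ 3 / 3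
  else (2 * kappa ^+ 3)^-1 *
    (- 3 + 2 * kappa * t + 4 * expR (- (kappa * t)) - expR (- (2 * kappa * t))).

Definition Gamma kappa alpha t : R :=
  if kappa == 0 then
    if alpha == 0 then t ^+ 2 / 2
    else (alpha ^+ 2)^-1 *
      (1 - expR (- (alpha * t)) - alpha * t * expR (- (alpha * t)))
  else kappa^-1 * (Psi alpha t - Psi (alpha + kappa) t).

Definition Lambda kappa alpha t : R :=
  if kappa == 0 then
    if alpha == 0 then t ^+ 3 / 3
    else (2 * alpha ^+ 3)^-1 *
      (- 2 + t ^+ 2 * alpha ^+ 2 + 2 * expR (- (alpha * t))
       + 2 * alpha * t * expR (- (alpha * t)))
  else
    if alpha == 0 then (2 * kappa ^+ 3)^-1 *
      (- 2 + t ^+ 2 * kappa ^+ 2 + 2 * expR (- (kappa * t))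
       + 2 * kappa * t * expR (- (kappa * t)))
    else (alpha * kappa)^-1 *
      (Psi (alpha + kappa) t - Psi alpha t - Psi kappa t + t).

End auxiliary_functions.

(* Order of the factors: r, S, pi. *)
Definition corr_mx (R : realType) (rho_rS rho_rpi rho_Spi : R) : 'M[R]_3 :=
  \matrix_(i < 3, j < 3)
    nth 0 (nth [::] [:: [:: 1;       rho_rS;  rho_rpi];
                        [:: rho_rS;  1;       rho_Spi];
                        [:: rho_rpi; rho_Spi; 1      ]] i) j.

Definition mean_vec (R : realType)
    (kappa alpha beta rbar xbar pibar t r0 x0 pi0 : R) : 7.-tuple R :=
  [tuple rbar + expR (- (kappa * t)) * (r0 - rbar);
         t * rbar + Psi kappa t * (r0 - rbar);
         xbar + expR (- (alpha * t)) * (x0 - xbar);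
         t * xbar + Psi alpha t * (x0 - xbar);
         pibar + expR (- (beta * t)) * (pi0 - pibar);
         t * pibar + Psi beta t * (pi0 - pibar);
         0].

Definition cov_mx (R : realType)
    (kappa alpha beta sr sx sp rho_rS rho_rpi rho_Spi t : R) : 'M[R]_7 :=
  let lower : seq (seq R) :=
    [:: [:: sr ^+ 2 * Psi (2 * kappa) t];
        [:: sr ^+ 2 * Gamma kappa kappa t;
            sr ^+ 2 * Upsilon kappa t];
        [:: - (sr * sx * rho_rS * Psi (kappa + alpha) t);
            - (sr * sx * rho_rS * Gamma kappa alpha t);
            sx ^+ 2 * Psi (2 * alpha) t];
        [:: - (sr * sx * rho_rS * Gamma alpha kappa t);
            - (sr * sx * rho_rS * Lambda kappa alpha t);
            sx ^+ 2 * Gamma alpha alpha t;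
            sx ^+ 2 * Upsilon alpha t];
        [:: sr * sp * rho_rpi * Psi (kappa + beta) t;
            sr * sp * rho_rpi * Gamma kappa beta t;
            - (sx * sp * rho_Spi * Psi (alpha + beta) t);
            - (sx * sp * rho_Spi * Gamma alpha beta t);
            sp ^+ 2 * Psi (2 * beta) t];
        [:: sr * sp * rho_rpi * Gamma beta kappa t;
            sr * sp * rho_rpi * Lambda kappa beta t;
            - (sx * sp * rho_Spi * Gamma beta alpha t);
            - (sx * sp * rho_Spi * Lambda alpha beta t);
            sp ^+ 2 * Gamma beta beta t;
            sp ^+ 2 * Upsilon beta t];
        [:: sr * rho_rS * Psi kappa t;
            sr * rho_rS * Theta kappa t;
            - (sx * Psi alpha t);
            - (sx * Theta alpha t);
            sp * rho_Spi * Psi beta t;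
            sp * rho_Spi * Theta beta t;
            t]]
  in \matrix_(i < 7, j < 7) nth 0 (nth [::] lower (maxn i j)) (minn i j).

(* Main.v *)
Require Import Defs.
From HB Require Import structures.
From mathcomp Require Import all_boot all_order all_algebra.
From mathcomp Require Import all_classical all_reals all_analysis.
From mathcomp Require Import measurable_realfun.
From mathcomp Require Import ring lra.

Set Implicit Arguments.
Unset Strict Implicit.
Unset Printing Implicit Defensive.

Import Order.TTheory GRing.Theory Num.Theory.
Import numFieldNormedType.Exports.

Local Open Scope classical_set_scope.
Local Open Scope ring_scope.

(* Summation by parts along a uniform mesh turns the three linear equations into
   Wiener integrals: pathwise, Y_t minus the mean evaluated at the initial values
   is a vector N whose coordinates are weight * int_0^t g(t - s) dW_s with
   g = e^(-k u), Psi(k, u) or 1.  Along the mesh N is a limit of finite sums of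
   Brownian increments; each such sum is independent of F_0, and every linear
   functional of it is Gaussian by hypothesis, with parameters read off from its
   moment generating function.  Independence and normality pass to the limit by
   testing laws against bounded continuous functions, and the variances become
   int_0^t g_i g_j, which are the functions Psi, Theta, Upsilon, Gamma, Lambda.
   As N is independent of the initial values, the law of the mean plus N is the
   conditional distribution. *)

(** * Riemann sums and the pathwise limit *)

(** A solution is given only through limits in probability of left-point sums, one time at a time.
    In the three linear equations the volatility is constant, so these sums telescope to
    [sigma * (W t - W 0)] for every partition. The integrated equation therefore holds almost surely
    at each time, hence off a single null set at the countably many mesh points, and the remaining
    limits are pathwise limits of Riemann sums. Degenerate cases are absorbed by uniform formulas: a
    normal law is the image of the standard one under [z |-> m + sqrt v * z], and all integrands
    satisfy [g' = kappa * g - c] whether or not [kappa] vanishes. Normality is claimed at every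
    initial value, not at almost every one. The kernel is therefore constructed explicitly, by
    translating the law of [N] by the mean. *)

Section riemann_sums.
Context {R : realType}.
Local Notation mu := (@lebesgue_measure R).
Implicit Types (f g F : R -> R) (a b t : R).

(** Compactness of [[a, b]] in near-covering form: around each point, half of the radius given by
    continuity serves all nearby [x]. Only [x] is confined to [[a, b]]; [y] may lie outside. *)
Lemma uniform_continuity_itv f a b : continuous f ->
  forall eps, 0 < eps -> exists2 delta, 0 < delta &
    forall x y, a <= x <= b -> `|x - y| < delta -> `|f x - f y| < eps.
Proof.
move=> cf eps eps0.
have /compact_near_coveringP := @segment_compact R a b.
move=> /(_ R 0^'+ (fun d x => forall y, `|x - y| < d -> `|f x - f y| < eps)
   (at_right_proper_filter 0)).
case=> [x xab|].
  have /cvgrPdist_lt /(_ (eps / 2)) := cf x.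
  rewrite divr_gt0// => /(_ isT)[/= e e0 He].
  exists (ball x (e / 2), `]0, (e / 2)[%classic) => /=.
    split; first by apply: nbhsx_ballx; rewrite divr_gt0.
    exists (e / 2) => /=; first by rewrite divr_gt0.
    move=> d /=; rewrite sub0r normrN => + d0.
    by rewrite gtr0_norm// in_itv/= d0.
  move=> [z d]/= [+ dI] y zy; rewrite /ball/= => xz.
  move: dI; rewrite in_itv/= => /andP[d0 de].
  rewrite -(subrKA (f x)) (le_lt_trans (ler_normD _ _))// (splitr eps) ltrD//.
    rewrite distrC; apply: He => /=; rewrite (lt_le_trans xz)// ler_pdivrMr//.
    by rewrite ler_peMr// ?ltW// ltr1n.
  apply: He => /=; rewrite -(subrKA z) (le_lt_trans (ler_normD _ _))//.
  by rewrite (splitr e) ltrD// (lt_trans zy).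
move=> d /= d0 Hd; exists (d / 2); first by rewrite divr_gt0.
move=> x y xab xy; apply: (Hd (d / 2)) => //=.
- rewrite sub0r normrN gtr0_norm ?divr_gt0// ltr_pdivrMr//.
  by rewrite ltr_pMr// ltr1n.
- by rewrite divr_gt0.
Qed.

Lemma continuous_integrable_itv f a b : continuous f ->
  mu.-integrable `[a, b] (EFin \o f).
Proof.
move=> cf; apply: continuous_compact_integrable; first exact: segment_compact.
exact: continuous_subspaceT.
Qed.

Lemma is_derive_Rintegral f a x : continuous f -> a < x ->
  is_derive x 1 (fun s => \int[mu]_(u in `[a, s]) f u) (f x).
Proof.
move=> cf ax.
have [dF F'] := @continuous_FTC1_closed R f a x (x + 1) (ltr_pwDr ltr01 (lexx x))
  (continuous_integrable_itv a (x + 1) cf) ax (cf x).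
apply: DeriveDef; first exact: dF.
by rewrite -F' derive1E.
Qed.

(** The mean value theorem for the primitive of [f]. It turns an exact increment of a time integral
    into one term of a Riemann sum. *)
Lemma Rintegral_mean_value f t a b : continuous f -> 0 <= a <= b -> b <= t ->
  exists2 c, a <= c <= b &
    \int[mu]_(u in `[0, b]) f u - \int[mu]_(u in `[0, a]) f u = f c * (b - a).
Proof.
move=> cf /andP[a0 ab] bt.
have [||c /itvP cab E] := @MVT_segment R (fun s => \int[mu]_(u in `[0, s]) f u) f a b ab.
- move=> x /itvP xab; apply: is_derive_Rintegral => //.
  by rewrite (le_lt_trans a0)// xab.
- have b0 : 0 <= b by exact: le_trans ab.
  have := parameterized_integral_continuous b0 (continuous_integrable_itv 0 b cf).
  apply: continuous_subspaceW => y /=; rewrite !in_itv/= => /andP[ay ->].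
  by rewrite (le_trans a0).
- by exists c => //; rewrite !cab.
Qed.

Lemma Rintegral_primitive f F t : 0 <= t -> continuous f ->
  (forall x : R, is_derive x 1 F (f x)) ->
  \int[mu]_(u in `[0, t]) f u = F t - F 0.
Proof.
rewrite le_eqVlt => /predU1P[<- _ _|t0 cf dF].
  by rewrite set_itv1 Rintegral_set1 subrr.
have cF : continuous F.
  by move=> x; apply: differentiable_continuous; apply/derivable1_diffP; case: (dF x).
rewrite /Rintegral (@continuous_FTC2 R f F)//.
- exact: continuous_subspaceT.
- split => [x _||]; first by case: (dF x).
  + exact/cvg_at_right_filter/cF.
  + exact/cvg_at_left_filter/cF.
- by move=> x _; rewrite derive1E; case: (dF x).
Qed.

(** There are [n.+1] cells, so no division by zero occurs at [n = 0]. *)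
Definition mesh t (n : nat) : R := t / n.+1%:R.
Definition mesh_point t (n k : nat) : R := mesh t n * k%:R.

Lemma mesh_ge0 t n : 0 <= t -> 0 <= mesh t n.
Proof. by move=> t0; rewrite divr_ge0. Qed.

Lemma mesh_point0 t n : mesh_point t n 0 = 0.
Proof. by rewrite /mesh_point mulr0. Qed.

Lemma mesh_pointT t n : mesh_point t n n.+1 = t.
Proof. by rewrite /mesh_point /mesh divfK. Qed.

Lemma mesh_pointS t n k : mesh_point t n k.+1 - mesh_point t n k = mesh t n.
Proof. by rewrite /mesh_point -mulrBr -natrB// subSnn mulr1. Qed.

Lemma mesh_point_ge0 t n k : 0 <= t -> 0 <= mesh_point t n k.
Proof. by move=> t0; rewrite mulr_ge0// mesh_ge0. Qed.

Lemma mesh_point_leS t n k : 0 <= t -> mesh_point t n k <= mesh_point t n k.+1.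
Proof. by move=> t0; rewrite -subr_ge0 mesh_pointS mesh_ge0. Qed.

Lemma mesh_point_le t n k : 0 <= t -> (k <= n.+1)%N -> mesh_point t n k <= t.
Proof.
by move=> t0 kn; rewrite -{2}(mesh_pointT t n) ler_wpM2l ?mesh_ge0// ler_nat.
Qed.

Lemma mesh_cvg0 t : mesh t n @[n --> \oo] --> 0.
Proof.
rewrite -(mulr0 t); apply: cvgMr; exact: cvg_harmonic.
Qed.

Definition tags t (xi : nat -> nat -> R) := forall n k, (k <= n)%N ->
  mesh_point t n k <= xi n k <= mesh_point t n k.+1.

Lemma mesh_tags t : 0 <= t -> tags t (mesh_point t).
Proof. by move=> t0 n k _; rewrite lexx/= mesh_point_leS. Qed.

(** The two factors may be evaluated at different points of a cell: in the applications one tag is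
    an end point and the other comes from a mean value theorem. On each cell, uniform continuity of
    both factors and a common bound [M] control the error. *)
Lemma riemann_sum_cvg f g t (xi eta : nat -> nat -> R) : 0 <= t ->
  continuous f -> continuous g -> tags t xi -> tags t eta ->
  \sum_(0 <= k < n.+1) mesh t n * (f (xi n k) * g (eta n k)) @[n --> \oo]
    --> \int[mu]_(s in `[0, t]) (f s * g s).
Proof.
move=> t0 cf cg txi teta; apply/cvgrPdist_le => eps eps0.
have [M M0 HM] : exists2 M, 0 < M &
    forall x, 0 <= x <= t -> `|f x| <= M /\ `|g x| <= M.
  have bnd (h : R -> R) : continuous h -> exists M, forall x, 0 <= x <= t -> `|h x| <= M.
    move=> ch; have [||c _ Hc] := @EVT_max R (fun x => `|h x|) 0 t => //.
      apply: continuous_subspaceT => x; apply: continuous_comp; first exact: ch.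
      exact: norm_continuous.
    by exists `|h c| => x xt; apply: Hc; rewrite in_itv.
  have [M1 H1] := bnd f cf; have [M2 H2] := bnd g cg.
  exists (1 + `|M1| + `|M2|); first by rewrite -addrA ltr_pwDl// addr_ge0.
  move=> x xt; split.
    by rewrite (le_trans (H1 _ xt))// (le_trans (ler_norm _))// addrAC lerDr addr_ge0.
  by rewrite (le_trans (H2 _ xt))// (le_trans (ler_norm _))// lerDr addr_ge0.
(* Using [t + 1] instead of [t] covers [t = 0]; the total error is then at most
   [t / (t + 1) * eps]. *)
pose e := eps / ((t + 1) * (M + M)).
have e0 : 0 < e by rewrite divr_gt0// mulr_gt0//; lra.
have [d1 d10 H1] := uniform_continuity_itv 0 t cf e0.
have [d2 d20 H2] := uniform_continuity_itv 0 t cg e0.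
have /cvgrPdist_lt/(_ (Num.min d1 d2)) := mesh_cvg0 t.
rewrite lt_min d10 d20 => /(_ isT); apply: filterS => n.
rewrite sub0r normrN ger0_norm ?mesh_ge0// lt_min => /andP[hd1 hd2].
have cfg : continuous (fun s => f s * g s) by move=> x; apply: cvgM; [exact: cf|exact: cg].
pose J s := \int[mu]_(u in `[0, s]) (f u * g u).
have -> : \int[mu]_(s in `[0, t]) (f s * g s) =
    \sum_(0 <= k < n.+1) (J (mesh_point t n k.+1) - J (mesh_point t n k)).
  rewrite telescope_sumr// mesh_pointT mesh_point0 /J.
  by rewrite set_itv1 Rintegral_set1 subr0.
rewrite -sumrB (le_trans (ler_norm_sum _ _ _))//.
have -> : eps = \sum_(0 <= k < n.+1) (eps / n.+1%:R).
  by rewrite sumr_const_nat subn0 -[RHS]mulr_natr divfK.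
rewrite !big_nat; apply: ler_sum => k /andP[_ kn].
set p := mesh_point t n k; set q := mesh_point t n k.+1.
have p0 : 0 <= p by exact: mesh_point_ge0.
have qt : q <= t by apply: mesh_point_le.
have pq : p <= q by exact: mesh_point_leS.
have [|c cpq ->] := @Rintegral_mean_value (fun s => f s * g s) t p q cfg _ qt.
  by rewrite p0.
rewrite mesh_pointS mulrC -mulrBr normrM ger0_norm ?mesh_ge0//.
have /andP[px xq] := txi n k kn; have /andP[py yq] := teta n k kn.
case/andP: cpq => pc cq.
have close x y : p <= x <= q -> p <= y <= q -> `|x - y| <= mesh t n.
  rewrite -(mesh_pointS t n k) -/p -/q => /andP[? ?] /andP[? ?].
  by rewrite ler_norml; apply/andP; split; lra.
have in0t x : p <= x <= q -> 0 <= x <= t.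
  by move=> /andP[? ?]; apply/andP; split; lra.
have Ic : p <= c <= q by rewrite pc.
have Ix : p <= xi n k <= q by rewrite px.
have Iy : p <= eta n k <= q by rewrite py.
rewrite (_ : f c * g c - _ = (f c - f (xi n k)) * g c + f (xi n k) * (g c - g (eta n k))); last by ring.
apply: (@le_trans _ _ (mesh t n * (e * M + M * e))).
  rewrite ler_wpM2l ?mesh_ge0// (le_trans (ler_normD _ _))// !normrM.
  have [_ gM] := HM _ (in0t _ Ic); have [fM _] := HM _ (in0t _ Ix).
  have ef : `|f c - f (xi n k)| <= e.
    by apply/ltW/H1; [exact: in0t|rewrite (le_lt_trans (close _ _ Ic Ix))].
  have eg : `|g c - g (eta n k)| <= e.
    by apply/ltW/H2; [exact: in0t|rewrite (le_lt_trans (close _ _ Ic Iy))].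
  by rewrite lerD// ler_pM.
rewrite (_ : _ * (_ + _) = (t / (t + 1)) * (eps / n.+1%:R)); last first.
  rewrite /mesh /e; have tt : t + 1 != 0 by lra.
  have : n.+1%:R != 0 :> R by rewrite pnatr_eq0.
  move: (n.+1%:R : R) => N N0.
  have MM' : M + M != 0 by rewrite gt_eqF// addr_gt0.
  by field; rewrite ?N0 ?tt ?MM'.
rewrite ler_piMl//; first by rewrite divr_ge0// ltW.
by rewrite ler_pdivrMr; lra.
Qed.

End riemann_sums.

(** * Derivatives of the auxiliary functions *)

Section auxiliary_derivatives.
Context {R : realType}.
Implicit Types (f g F : R -> R) (kappa alpha t u a b : R).

Lemma is_derive_eq1 f u a b : is_derive u 1 f a -> a = b -> is_derive u 1 f b.
Proof. by move=> + <-. Qed.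

Lemma is_derive_fun_add f g u a b : is_derive u 1 f a -> is_derive u 1 g b ->
  is_derive u 1 (fun s => f s + g s) (a + b).
Proof. exact: is_deriveD. Qed.

Lemma is_derive_fun_opp f u a : is_derive u 1 f a ->
  is_derive u 1 (fun s => - f s) (- a).
Proof. exact: is_deriveN. Qed.

Lemma is_derive_fun_mul f g u a b : is_derive u 1 f a -> is_derive u 1 g b ->
  is_derive u 1 (fun s => f s * g s) (f u * b + g u * a).
Proof. exact: is_deriveM. Qed.

Lemma is_derive_fun_cst (c : R) u : is_derive u 1 (fun _ : R => c) 0.
Proof. exact: is_derive_cst. Qed.

Lemma is_derive_fun_id u : is_derive u 1 (fun s : R => s) 1.
Proof. exact: is_derive_id. Qed.

Lemma is_derive_fun_comp f g u a b : is_derive u 1 g b -> is_derive (g u) 1 f a ->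
  is_derive u 1 (fun s => f (g s)) (b * a).
Proof. by move=> dg df; have := @is_derive1_comp R f g u a b df dg; rewrite mulrC. Qed.

Lemma is_derive_fun_exp f u a : is_derive u 1 f a ->
  is_derive u 1 (fun s => expR (f s)) (a * expR (f u)).
Proof. by move=> df; apply: is_derive_fun_comp df _; exact: is_derive_expR. Qed.

Lemma is_derive_continuous f (df : R -> R) :
  (forall u : R, is_derive u 1 f (df u)) -> continuous f.
Proof.
by move=> dF x; apply: differentiable_continuous; apply/derivable1_diffP; case: (dF x).
Qed.

End auxiliary_derivatives.

(** The derivative starts as an existential variable and is filled in by the shape of the function;
    what remains is its equality with the announced value, for [ring] or [field]. Derivatives of
    [Psi] put in the context beforehand are found by [eassumption]. *)
Ltac prove_derive := eapply is_derive_eq1;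
  [repeat first [ eassumption | eapply is_derive_fun_cst | eapply is_derive_fun_id
                | eapply is_derive_fun_exp
                | eapply is_derive_fun_add | eapply is_derive_fun_opp
                | eapply is_derive_fun_mul ] | cbv beta].

Section auxiliary_functions.
Context {R : realType}.
Implicit Types (kappa alpha t u : R).
Local Notation mu := (@lebesgue_measure R).

Lemma is_derive_decay kappa u :
  is_derive u 1 (fun s => expR (- (kappa * s))) (- kappa * expR (- (kappa * u))).
Proof. by prove_derive; ring. Qed.

(** One formula covers both branches of the definition, so a vanishing sum such as [kappa + alpha]
    needs no case of its own later. *)
Lemma is_derive_Psi kappa u : is_derive u 1 (Psi kappa) (expR (- (kappa * u))).
Proof.
rewrite /Psi; have [->|k0] := eqVneq kappa 0.
  by rewrite mul0r oppr0 expR0; exact: is_derive_fun_id.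
by prove_derive; field; exact: k0.
Qed.

(** This relation and its integral [ThetaE] hold for [kappa = 0] too; they bring the deterministic
    part of the solution to the form of the mean vector. *)
Lemma decayE kappa u : expR (- (kappa * u)) = 1 - kappa * Psi kappa u.
Proof.
rewrite /Psi; have [->|k0] := eqVneq kappa 0; first by rewrite !mul0r oppr0 expR0 addr0.
by rewrite mulVKf// opprB addrC subrK.
Qed.

Lemma decayD kappa alpha u :
  expR (- ((kappa + alpha) * u)) = expR (- (kappa * u)) * expR (- (alpha * u)).
Proof. by rewrite -expRD; congr expR; ring. Qed.

Lemma decay_neq0_PsiE kappa u : kappa != 0 ->
  Psi kappa u = kappa^-1 * (1 - expR (- (kappa * u))).
Proof. by rewrite /Psi => /negPf ->. Qed.

Lemma is_derive_PsiD kappa alpha u :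
  is_derive u 1 (Psi (kappa + alpha)) (expR (- (kappa * u)) * expR (- (alpha * u))).
Proof. by rewrite -decayD; exact: is_derive_Psi. Qed.

Lemma is_derive_Theta kappa u : is_derive u 1 (Theta kappa) (Psi kappa u).
Proof.
rewrite /Theta /Psi; have [k0|k0] := eqVneq kappa 0.
  by rewrite /GRing.exp/=; prove_derive; field.
by prove_derive; field; exact: k0.
Qed.

Lemma ThetaE kappa t : kappa * Theta kappa t = t - Psi kappa t.
Proof.
rewrite /Theta /Psi; have [->|k0] := eqVneq kappa 0; first by rewrite mul0r subrr.
by field.
Qed.

Lemma is_derive_Upsilon kappa u : is_derive u 1 (Upsilon kappa) (Psi kappa u * Psi kappa u).
Proof.
rewrite /Upsilon /Psi; have [k0|k0] := eqVneq kappa 0.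
  by rewrite /GRing.exp/=; prove_derive; field.
(* With the exponent written as a sum, [decayD] expresses everything in [expR (- (kappa * u))], and
   the identity becomes polynomial in it. *)
prove_derive; have -> : 2 * kappa = kappa + kappa by ring.
by rewrite decayD; field; exact: k0.
Qed.

Lemma is_derive_Gamma kappa alpha u :
  is_derive u 1 (Gamma kappa alpha) (Psi kappa u * expR (- (alpha * u))).
Proof.
rewrite /Gamma; have [->|k0] := eqVneq kappa 0.
  rewrite /Psi eqxx; have [->|a0] := eqVneq alpha 0.
    by rewrite /GRing.exp/= mul0r oppr0 expR0; prove_derive; field.
  by prove_derive; field; exact: a0.
have dP := is_derive_Psi alpha u; have dQ := is_derive_PsiD alpha kappa u.
by prove_derive; rewrite (decay_neq0_PsiE u k0); field; exact: k0.
Qed.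

Lemma is_derive_Lambda kappa alpha u :
  is_derive u 1 (Lambda kappa alpha) (Psi kappa u * Psi alpha u).
Proof.
rewrite /Lambda; have [->|k0] := eqVneq kappa 0; have [->|a0] := eqVneq alpha 0.
- by rewrite /Psi eqxx /GRing.exp/=; prove_derive; field.
- rewrite /Psi eqxx (negPf a0) /GRing.exp/=; prove_derive; field; exact: a0.
- rewrite /Psi eqxx (negPf k0) /GRing.exp/=; prove_derive; field; exact: k0.
- have dP := is_derive_Psi alpha u; have dQ := is_derive_PsiD alpha kappa u.
  have dS := is_derive_Psi kappa u.
  prove_derive; rewrite (decay_neq0_PsiE u k0) (decay_neq0_PsiE u a0); field.
  by rewrite a0 k0.
Qed.

Lemma Psi0 kappa : Psi kappa 0 = 0.
Proof. by rewrite /Psi mulr0 oppr0 expR0 subrr mulr0 if_same. Qed.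

Lemma Theta0 kappa : Theta kappa 0 = 0.
Proof. by rewrite /Theta mulr0 oppr0 expR0 addr0 addNr mulr0 expr0n/= mul0r if_same. Qed.

Lemma Upsilon0 kappa : Upsilon kappa 0 = 0.
Proof.
rewrite /Upsilon !mulr0 oppr0 expR0 expr0n/= mul0r.
by rewrite (_ : - 3 + 0 + 4 * 1 - 1 = 0 :> R) ?mulr0 ?if_same//; ring.
Qed.

Lemma Gamma0 kappa alpha : Gamma kappa alpha 0 = 0.
Proof.
rewrite /Gamma !Psi0 subrr !mulr0 oppr0 expR0 expr0n/= !mul0r subr0 subrr.
by rewrite !mulr0 !if_same.
Qed.

Lemma Lambda0 kappa alpha : Lambda kappa alpha 0 = 0.
Proof.
rewrite /Lambda !Psi0 !mulr0 oppr0 expR0 !expr0n/= !mul0r !addr0 !mulr1.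
by rewrite addNr !mulr0 !if_same.
Qed.

(** [- F (t - s)] is a primitive in [s], so no change of variables is needed. *)
Lemma Rintegral_reversed (f F : R -> R) t : 0 <= t -> continuous f ->
  (forall u, is_derive u 1 F (f u)) -> F 0 = 0 ->
  \int[mu]_(s in `[0, t]) f (t - s) = F t.
Proof.
move=> t0 cf dF F0.
have cft : continuous (fun s => f (t - s)).
  move=> s; apply: (@continuous_comp _ _ _ (fun s : R => t - s) f); last exact: cf.
  by apply: cvgB; [exact: cvg_cst|exact: cvg_id].
have dFt (s : R) : is_derive s 1 (fun s => - F (t - s)) (f (t - s)).
  have dFs := is_derive_fun_comp (is_derive_fun_add
    (is_derive_fun_cst t s) (is_derive_fun_opp (is_derive_fun_id s))) (dF (t - s)).
  by apply: (is_derive_eq1 (is_derive_fun_opp dFs)); ring.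
by rewrite (Rintegral_primitive t0 cft dFt) subrr subr0 F0; ring.
Qed.

End auxiliary_functions.

(** * Summation by parts along one path *)

Section pathwise_limit.
Context {R : realType}.
Local Notation mu := (@lebesgue_measure R).

Lemma mean_value_tags (t : R) (f : R -> R) (G : R -> R -> R) : 0 <= t ->
  (forall a b, 0 <= a <= b -> b <= t ->
     exists2 c, a <= c <= b & G a b = f c * (b - a)) ->
  exists2 xi, tags t xi & forall n k, (k <= n)%N ->
    G (mesh_point t n k) (mesh_point t n k.+1) = f (xi n k) * mesh t n.
Proof.
move=> t0 H.
(* One choice over all pairs [(n, k)]; for [k > n] the tag is the irrelevant value 0. *)
have /choice[xi Hxi] (nk : nat * nat) : exists c : R, (nk.2 <= nk.1)%N ->
    mesh_point t nk.1 nk.2 <= c <= mesh_point t nk.1 nk.2.+1 /\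
    G (mesh_point t nk.1 nk.2) (mesh_point t nk.1 nk.2.+1) = f c * mesh t nk.1.
  case: nk => n k /=; have [kn|_] := leqP k n; last by exists 0.
  have [||c Hc E] := H (mesh_point t n k) (mesh_point t n k.+1).
  - by rewrite mesh_point_ge0//= mesh_point_leS.
  - exact: mesh_point_le.
  - by exists c => _; split => //; rewrite E mesh_pointS.
exists (fun n k => xi (n, k)) => [n k kn|n k kn].
  by have [] := Hxi (n, k) kn.
by have [_ ->] := Hxi (n, k) kn.
Qed.

(* Summation by parts moves the increments of x onto g, and the drift cancels
   the remaining kappa * g because g' = kappa * g - c. *)
Lemma wiener_sum_cvg (x g : R -> R) (kappa xbar c t b : R) (w : nat -> nat -> R) :
  let J s := \int[mu]_(u in `[0, s]) x u in
  0 <= t -> continuous x ->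
  (forall s : R, is_derive s 1 g (kappa * g s - c)) ->
  (forall n k, (k <= n)%N -> b * w n k =
     x (mesh_point t n k.+1) - x (mesh_point t n k)
     - kappa * (xbar * mesh t n - (J (mesh_point t n k.+1) - J (mesh_point t n k)))) ->
  b * \sum_(0 <= k < n.+1) g (mesh_point t n k) * w n k @[n --> \oo] -->
    g t * x t - g 0 * x 0 + c * J t - kappa * xbar * \int[mu]_(s in `[0, t]) g s.
Proof.
move=> J t0 cx dg Hw.
have cg : continuous g by exact: is_derive_continuous dg.
have cg' : continuous (fun s => kappa * g s - c).
  move=> s; apply: cvgB; last exact: cvg_cst.
  by apply: cvgMr; exact: cg.
have MV a d : 0 <= a <= d -> d <= t ->
    exists2 z, a <= z <= d & g d - g a = (kappa * g z - c) * (d - a).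
  move=> /andP[a0 ad] dt.
  have [|z zab ->] := @MVT_segment R g (fun s => kappa * g s - c) a d ad
    (fun s _ => dg s); first exact: continuous_subspaceT.
  by exists z => //; move: zab; rewrite in_itv.
have [xi txi Hxi] := @mean_value_tags t (fun s => kappa * g s - c) _ t0 MV.
have [zeta tzeta Hzeta] := @mean_value_tags t x _ t0
  (fun a b Hab Hb => Rintegral_mean_value cx Hab Hb).
(* Summation by parts pairs [x] at the right end with [g'] at the tag [xi]; the drift pairs [g] at
   the left end with [x] at the tag [zeta]. *)
pose pl n k := mesh_point t n k; pose pr n k := mesh_point t n k.+1.
have tl : tags t pl := mesh_tags t0.
have tr : tags t pr by move=> n k kn; rewrite /pr lexx andbT mesh_point_leS.
have C1 := riemann_sum_cvg t0 cg' cx txi tr.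
have C2 := riemann_sum_cvg t0 cg cx tl tzeta.
have C3 := riemann_sum_cvg t0 cg (@cst_continuous _ _ (1 : R)) tl tl.
have cgx : continuous (fun s => g s * x s) by move=> s; apply: cvgM; [exact: cg|exact: cx].
(* The limit is rewritten as the combination of integrals approached by the three Riemann sums; the
   two copies of [kappa * g * x] cancel. *)
have E : g t * x t - g 0 * x 0 + c * J t - kappa * xbar * \int[mu]_(s in `[0, t]) g s =
    g t * x t - g 0 * x 0 - \int[mu]_(s in `[0, t]) ((kappa * g s - c) * x s)
    + (kappa * \int[mu]_(s in `[0, t]) (g s * x s)
      - kappa * xbar * \int[mu]_(s in `[0, t]) (g s * 1)).
  rewrite -addrA -[in RHS]addrA; congr (_ + _).
  under [X in _ = - X + _]eq_Rintegral do rewrite mulrBl -mulrA.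
  under [X in _ = _ + (_ - _ * X)]eq_Rintegral do rewrite mulr1.
  rewrite RintegralB//; last 2 first.
  - apply: (@continuous_integrable_itv R (fun s => kappa * (g s * x s))).
    by move=> s; apply: cvgMr; exact: cgx.
  - apply: (@continuous_integrable_itv R (fun s => c * x s)).
    by move=> s; apply: cvgMr; exact: cx.
  rewrite !RintegralZl//; last 2 first.
  - exact: continuous_integrable_itv.
  - exact: continuous_integrable_itv.
  by rewrite /J; ring.
rewrite E.
apply: (@cvg_trans _ ((g t * x t - g 0 * x 0
   - \sum_(0 <= k < n.+1) mesh t n * ((kappa * g (xi n k) - c) * x (pr n k))
   + (kappa * (\sum_(0 <= k < n.+1) mesh t n * (g (pl n k) * x (zeta n k)))
   - kappa * xbar * (\sum_(0 <= k < n.+1) mesh t n * (g (pl n k) * 1)))) @[n --> \oo])); last first.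
  apply: cvgD; first by apply: cvgB; [exact: cvg_cst|exact: C1].
  by apply: cvgB; apply: cvgMr; [exact: C2|exact: C3].
apply: near_eq_cvg; apply: nearW => n.
have -> : g t * x t - g 0 * x 0 = \sum_(0 <= k < n.+1) (g (pr n k) * x (pr n k) - g (pl n k) * x (pl n k)).
  rewrite (@telescope_sumr _ 0%N n.+1 (fun k => g (mesh_point t n k) * x (mesh_point t n k)))//.
  by rewrite mesh_pointT mesh_point0.
rewrite !mulr_sumr -!sumrB -!big_split/=; apply: eq_big_nat => k /andP[_ kn].
have := Hxi n k kn; have := Hzeta n k kn; have := Hw n k kn.
rewrite -/(pl n k) -/(pr n k) => W Z X.
rewrite [b * (_ * _)]mulrCA W Z.
have -> : mesh t n * ((kappa * g (xi n k) - c) * x (pr n k)) = (g (pr n k) - g (pl n k)) * x (pr n k).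
  by rewrite X; ring.
by ring.
Qed.

End pathwise_limit.

(** * Laws determined by test functions; normal laws *)

Section laws.
Context {R : realType}.

Definition image_measure d1 d2 (T1 : measurableType d1) (T2 : measurableType d2)
    (m : {measure set T1 -> \bar R}) (f : T1 -> T2) (mf : measurable_fun setT f) :
    {measure set T2 -> \bar R} :=
  measure_function_pushforward__canonical__measure_function_Measure m mf.

(** Uniqueness of a finite measure on a generating pi-system, applied to the two image measures. The
    variables may live on different spaces, so a law under [P] can be compared with one under the
    Gaussian measure. *)
Lemma eq_law_setI_closed d d1 d2 (T : measurableType d) (T1 : measurableType d1)
    (T2 : measurableType d2) (m1 : {measure set T1 -> \bar R})
    (m2 : {measure set T2 -> \bar R}) (V1 : T1 -> T) (V2 : T2 -> T)
    (G : set (set T)) :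
  (m1 setT < +oo)%E -> measurable_fun setT V1 -> measurable_fun setT V2 ->
  measurable = <<s G >> -> setI_closed G -> G setT ->
  (forall B, G B -> m1 (V1 @^-1` B) = m2 (V2 @^-1` B)) ->
  forall B, measurable B -> m1 (V1 @^-1` B) = m2 (V2 @^-1` B).
Proof.
move=> m1oo mV1 mV2 mG GI GT GE B mB.
apply: (@measure_unique d R T G (fun=> setT) mG GI (fun=> GT) _
  (image_measure m1 mV1) (image_measure m2 mV2)) => //.
by rewrite bigcup_const.
Qed.

Lemma eq_law_prod d d' d1 d2 (T : measurableType d) (T' : measurableType d')
    (T1 : measurableType d1) (T2 : measurableType d2)
    (m1 : {measure set T1 -> \bar R}) (m2 : {measure set T2 -> \bar R})
    (V1 : T1 -> T * T') (V2 : T2 -> T * T') :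
  (m1 setT < +oo)%E -> measurable_fun setT V1 -> measurable_fun setT V2 ->
  (forall A B, measurable A -> measurable B ->
     m1 (V1 @^-1` (A `*` B)) = m2 (V2 @^-1` (A `*` B))) ->
  forall C, measurable C -> m1 (V1 @^-1` C) = m2 (V2 @^-1` C).
Proof.
move=> m1oo mV1 mV2 H; apply: (eq_law_setI_closed m1oo mV1 mV2
  (measurable_prod_measurableType T T')) => /=.
- move=> _ _ [A mA [B mB <-]] [A' mA' [B' mB' <-]].
  exists (A `&` A'); first exact: measurableI.
  by exists (B `&` B'); [exact: measurableI|rewrite setXI].
- by exists setT => //; exists setT => //; rewrite setXTT.
- by move=> _ [A mA [B mB <-]]; exact: H.
Qed.

(** Continuity is sequential and coordinatewise, exactly what dominated convergence consumes. Values
    in [[0, 1]] make the class stable under products and dominated by 1. *)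
Definition test_fun n (f : n.-tuple R -> R) : Prop :=
  [/\ measurable_fun setT f, forall x, 0 <= f x <= 1 &
      forall (xs : nat -> n.-tuple R) x,
        (forall i, tnth (xs k) i @[k --> \oo] --> tnth x i) ->
        f (xs k) @[k --> \oo] --> f x].

Lemma test_funM n (f g : n.-tuple R -> R) :
  test_fun f -> test_fun g -> test_fun (fun x => f x * g x).
Proof.
move=> [mf f01 cf] [mg g01 cg]; split.
- exact: measurable_funM.
- move=> x; have /andP[f0 f1] := f01 x; have /andP[g0 g1] := g01 x.
  by rewrite mulr_ge0//= mulr_ile1.
- by move=> xs x cx; apply: cvgM; [exact: cf|exact: cg].
Qed.

Lemma test_fun_cst1 n : test_fun (fun _ : n.-tuple R => 1).
Proof.
split=> [|x|xs x _]; [exact: measurable_cst|by rewrite ler01 lexx|exact: cvg_cst].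
Qed.

(** These sets form a pi-system, since products of test functions approximate intersections, and
    they generate the product sigma-algebra, since they contain the coordinate rays. *)
Definition test_limit n : set (set (n.-tuple R)) := [set B | measurable B /\
  exists2 f : nat -> n.-tuple R -> R, (forall m, test_fun (f m)) &
    forall x, f m x @[m --> \oo] --> (\1_B x : R)].

Lemma test_limitI n : setI_closed (@test_limit n).
Proof.
move=> A B [mA [f tf fA]] [mB [g tg gB]]; split; first exact: measurableI.
exists (fun m x => f m x * g m x) => [m|x]; first exact: test_funM.
by rewrite indicI; apply: cvgM.
Qed.

Lemma test_limitT n : test_limit [set: n.-tuple R].
Proof.
split=> //; exists (fun _ _ => 1) => [m|x]; first exact: test_fun_cst1.
by rewrite indicT; exact: cvg_cst.
Qed.

Lemma test_limit_ray n (i : 'I_n) (a : R) :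
  test_limit ((fun x : n.-tuple R => tnth x i) @^-1` `]a, +oo[).
Proof.
split.
  by rewrite -[X in measurable X]setTI; apply: measurable_tnth.
(* A ramp of slope [m] starting at [a]: it is 0 up to [a] and tends to 1 at each point beyond. *)
pose c m (y : R) := Num.min 1 (Num.max 0 (m%:R * (y - a))).
have cc m : continuous (c m).
  have -> : c m = (cst 1 : R -> R^o) \min ((cst 0 : R -> R^o) \max
    (fun y : R => m%:R * (y - a) : R^o)) by [].
  move=> y; apply: continuous_min; first exact: cvg_cst.
  apply: continuous_max; first exact: cvg_cst.
  by apply: cvgMr; apply: cvgB; [exact: cvg_id|exact: cvg_cst].
exists (fun m x => c m (tnth x i)) => [m|x].
  split.
  - apply: (@measurableT_comp _ _ _ _ _ _ (c m) setT (fun x => tnth x i)).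
      exact: continuous_measurable_fun.
    exact: measurable_tnth.
  - by move=> x; rewrite /c le_min ge_min lexx ler01 le_max lexx.
  - by move=> xs x cx; apply: (@cvg_comp _ _ _ _ (c m) _ _ _ (cx i)); exact: cc.
rewrite indicE; case: (ltP a (tnth x i)) => ax.
  rewrite mem_set/=; last by rewrite in_itv/= ax.
  apply: cvg_near_cst; near=> m.
  rewrite /c min_l// le_max; apply/orP; right.
  rewrite -ler_pdivrMr ?subr_gt0// mul1r.
  near: m; exact: nbhs_infty_ger.
rewrite memNset/=; last by rewrite in_itv/= andbT ltNge ax.
apply: cvg_near_cst; apply: nearW => m; rewrite /c max_l ?min_r//.
by rewrite mulr_ge0_le0 ?subr_le0.
Unshelve. all: by end_near. Qed.

Lemma measurable_test_limit n : @measurable _ (n.-tuple R) = <<s @test_limit n >>.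
Proof.
apply/seteqP; split; last first.
  apply: smallest_sub; first exact: sigma_algebra_measurable.
  by move=> B [].
apply: smallest_sub; first exact: smallest_sigma_algebra.
move=> B; rewrite -bigcup_seq/= => -[i _ [A mA <-]]; rewrite setTI.
have mi : measurable_fun setT
    ((fun x => tnth x i) : g_sigma_algebraType (@test_limit n) -> R).
  apply: (measurability _ (@RGenOInfty.measurableE R)).
  move=> _ [_ [a ->] <-]; rewrite setTI.
  by apply: sub_sigma_algebra; exact: test_limit_ray.
by have := mi measurableT A mA; rewrite setTI.
Qed.

Lemma dominated_cvg1 d (T : measurableType d) (m : {measure set T -> \bar R})
    (f_ : nat -> T -> R) (f : T -> R) :
  (m setT < +oo)%E -> (forall k, measurable_fun setT (f_ k)) ->
  measurable_fun setT f -> (forall k x, 0 <= f_ k x <= 1) ->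
  {ae m, forall x, f_ k x @[k --> \oo] --> f x} ->
  (\int[m]_x (f_ k x)%:E @[k --> \oo] --> \int[m]_x (f x)%:E)%E.
Proof.
move=> moo mf_ mf f01 cf.
have [] := @dominated_convergence _ _ _ m setT measurableT
  (fun k x => (f_ k x)%:E) (EFin \o f) (cst 1%E) => //.
- by move=> k; exact/measurable_EFinP.
- exact/measurable_EFinP.
- apply: filterS cf => x cfx _; apply/fine_cvgP; split; first exact: nearW.
  exact: cfx.
- apply/integrableP; split; first exact: measurable_cst.
  under eq_integral do rewrite /= normr1.
  by rewrite integral_cst// mul1e.
- apply: nearW => x k _; rewrite /= lee_fin.
  by have /andP[f0 f1] := f01 k x; rewrite ger0_norm.
Qed.

Section test_laws.
Context d1 d2 (T1 : measurableType d1) (T2 : measurableType d2) (n : nat).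
Variables (m1 : {measure set T1 -> \bar R}) (m2 : {measure set T2 -> \bar R}).
Hypotheses (m1oo : (m1 setT < +oo)%E) (m2oo : (m2 setT < +oo)%E).

Lemma eq_law_test (V1 : T1 -> n.-tuple R) (V2 : T2 -> n.-tuple R) :
  measurable_fun setT V1 -> measurable_fun setT V2 ->
  (forall f, test_fun f ->
    (\int[m1]_x (f (V1 x))%:E = \int[m2]_x (f (V2 x))%:E)%E) ->
  forall B, measurable B -> m1 (V1 @^-1` B) = m2 (V2 @^-1` B).
Proof.
move=> mV1 mV2 H; apply: (eq_law_setI_closed m1oo mV1 mV2 (measurable_test_limit n)
  (@test_limitI n) (test_limitT n)).
move=> B [mB [f tf fB]].
have mE d (T : measurableType d) (m : {measure set T -> \bar R}) (V : T -> n.-tuple R) :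
    (m setT < +oo)%E -> measurable_fun setT V ->
    (\int[m]_x (f k (V x))%:E @[k --> \oo] --> m (V @^-1` B))%E.
  move=> moo mV; have mVB : measurable (V @^-1` B).
    by rewrite -[X in measurable X]setTI; exact: mV.
  have <- : (\int[m]_x (\1_(V @^-1` B) x)%:E = m (V @^-1` B))%E.
    by rewrite integral_indic// setIT.
  apply: (@dominated_cvg1 _ _ m (fun k x => f k (V x)) (\1_(V @^-1` B))) => //.
  - by move=> k; have [mf _ _] := tf k; exact: measurableT_comp.
  - by move=> k x; have [_ + _] := tf k; exact.
  - by apply: nearW => x; exact: fB.
have C1 := mE _ _ m1 V1 m1oo mV1; have C2 := mE _ _ m2 V2 m2oo mV2.
apply: (cvg_unique (@ereal_hausdorff R) C1).
apply: cvg_trans C2; apply: near_eq_cvg.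
by apply: nearW => k; rewrite H.
Qed.

Lemma eq_law_limit (V1 : nat -> T1 -> n.-tuple R) (V2 : nat -> T2 -> n.-tuple R)
    (W1 : T1 -> n.-tuple R) (W2 : T2 -> n.-tuple R) :
  (forall k, measurable_fun setT (V1 k)) -> (forall k, measurable_fun setT (V2 k)) ->
  measurable_fun setT W1 -> measurable_fun setT W2 ->
  {ae m1, forall x, forall i, tnth (V1 k x) i @[k --> \oo] --> tnth (W1 x) i} ->
  {ae m2, forall x, forall i, tnth (V2 k x) i @[k --> \oo] --> tnth (W2 x) i} ->
  (forall k f, test_fun f ->
    (\int[m1]_x (f (V1 k x))%:E = \int[m2]_x (f (V2 k x))%:E)%E) ->
  forall B, measurable B -> m1 (W1 @^-1` B) = m2 (W2 @^-1` B).
Proof.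
move=> mV1 mV2 mW1 mW2 c1 c2 H; apply: eq_law_test => // f tf.
have [mf f01 cf] := tf.
have C1 : (\int[m1]_x (f (V1 k x))%:E @[k --> \oo] --> \int[m1]_x (f (W1 x))%:E)%E.
  apply: (@dominated_cvg1 _ _ m1 (fun k x => f (V1 k x)) (fun x => f (W1 x))) => //.
  - by move=> k; exact: measurableT_comp.
  - exact: measurableT_comp.
  - by apply: filterS c1 => x; exact: cf.
have C2 : (\int[m2]_x (f (V2 k x))%:E @[k --> \oo] --> \int[m2]_x (f (W2 x))%:E)%E.
  apply: (@dominated_cvg1 _ _ m2 (fun k x => f (V2 k x)) (fun x => f (W2 x))) => //.
  - by move=> k; exact: measurableT_comp.
  - exact: measurableT_comp.
  - by apply: filterS c2 => x; exact: cf.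
apply: (cvg_unique (@ereal_hausdorff R) C1).
apply: cvg_trans C2; apply: near_eq_cvg.
by apply: nearW => k; rewrite H.
Qed.

End test_laws.

Lemma eq_law_integral d d1 d2 (T : measurableType d) (T1 : measurableType d1)
    (T2 : measurableType d2) (m1 : {measure set T1 -> \bar R})
    (m2 : {measure set T2 -> \bar R}) (V1 : T1 -> T) (V2 : T2 -> T) (f : T -> \bar R) :
  measurable_fun setT V1 -> measurable_fun setT V2 ->
  (forall B, measurable B -> m1 (V1 @^-1` B) = m2 (V2 @^-1` B)) ->
  measurable_fun setT f -> (forall x, 0 <= f x)%E ->
  (\int[m1]_x f (V1 x) = \int[m2]_x f (V2 x))%E.
Proof.
move=> mV1 mV2 H mf f0.
rewrite -[LHS](@ge0_integral_pushforward _ _ _ _ _ _ mV1 m1 setT f)//.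
rewrite -[RHS](@ge0_integral_pushforward _ _ _ _ _ _ mV2 m2 setT f)//.
apply: (@eq_measure_integral _ _ _ setT (image_measure m2 mV2) (image_measure m1 mV1)).
by move=> A mA _; exact: H.
Qed.

End laws.

(** * Normal laws: affine images, moment generating function, limits *)

Section normal_laws.
Context {R : realType}.
Local Notation mu := (@lebesgue_measure R).
Local Notation gauss := (normal_prob (0 : R) 1).

Import HBNNSimple.

(** Checked on nonnegative simple functions, then extended by monotone convergence; it converts
    Gaussian expectations into Lebesgue integrals. *)
Lemma ge0_integral_density d (T : measurableType d) (m nu : {measure set T -> \bar R})
    (g : T -> R) (f : T -> \bar R) :
  measurable_fun setT g -> (forall x, 0 <= g x) ->
  (forall A, measurable A -> nu A = \int[m]_(x in A) (g x)%:E)%E ->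
  measurable_fun setT f -> (forall x, 0 <= f x)%E ->
  (\int[nu]_x f x = \int[m]_x (f x * (g x)%:E))%E.
Proof.
move=> mg g0 nuE mf f0.
pose f_ := nnsfun_approx measurableT mf.
have fE x : (limn (fun n => (f_ n x)%:E) = f x)%E.
  by apply/cvg_lim => //; apply: cvg_nnsfun_approx => // ? _; exact: f0.
have nd x : {homo (fun n => (f_ n x)%:E) : a b / (a <= b)%N >-> (a <= b)%E}.
  by move=> a b ab; rewrite lee_fin; exact/lefP/nd_nnsfun_approx.
have step n : (\int[nu]_x (f_ n x)%:E = \int[m]_x ((f_ n x)%:E * (g x)%:E))%E.
  rewrite integralT_nnsfun sintegralE.
  have E x : ((f_ n x)%:E * (g x)%:E = \sum_(r \in range (f_ n))
      ((r * \1_(f_ n @^-1` [set r]) x)%:E * (g x)%:E))%E.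
    rewrite {1}fimfunE -fsumEFin// ge0_mule_fsuml// => r.
    exact: nnfun_muleindic_ge0.
  under [RHS]eq_integral do rewrite E.
  rewrite ge0_integral_fsum//.
  - apply: eq_fsbigr => r _; rewrite nuE//.
    rewrite [in RHS](eq_integral (fun x => r%:E * ((\1_(f_ n @^-1` [set r]) x)%:E * (g x)%:E))%E); last first.
      by move=> x _; rewrite EFinM muleA.
    (* The level sets of a nonnegative function at negative values are empty. *)
    have [r0|r0] := leP 0 r; last first.
      rewrite preimage_nnfun0// integral_set0 mule0 integral0_eq// => x _.
      by rewrite indic0 mul0e mule0.
    rewrite ge0_integralZl//=; last 2 first.
    + by apply: emeasurable_funM; exact/measurable_EFinP.
    + by move=> x _; rewrite mule_ge0// lee_fin.
    congr (r%:E * _)%E; rewrite integral_mkcond; apply: eq_integral => x _.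
    by rewrite patchE indicE; case: ifP => _; rewrite ?mul1e ?mul0e.
  - move=> r; apply: emeasurable_funM; apply/measurable_EFinP => //.
    exact: measurable_funM.
  - move=> r x _; rewrite mule_ge0 ?lee_fin//.
    by have := nnfun_muleindic_ge0 (f_ n) r x; rewrite -EFinM lee_fin.
transitivity (limn (fun n => \int[nu]_x (f_ n x)%:E))%E.
  rewrite -monotone_convergence//.
  - by apply: eq_integral => x _; rewrite fE.
  - by move=> n; exact/measurable_EFinP.
  - by move=> n x _; rewrite lee_fin.
transitivity (limn (fun n => \int[m]_x ((f_ n x)%:E * (g x)%:E)))%E.
  by apply: congr_lim; apply/funext => n; exact: step.
rewrite -monotone_convergence//.
- apply: eq_integral => x _; apply/cvg_lim => //.
  by apply: cvgeZr => //; apply: cvg_nnsfun_approx => // ? _; exact: f0.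
- by move=> n; apply: emeasurable_funM; exact/measurable_EFinP.
- by move=> n x _; rewrite mule_ge0// lee_fin.
- by move=> x _ a b ab; rewrite lee_wpmul2r ?lee_fin//; exact: nd.
Qed.

Lemma measurable_affine (m s : R) : measurable_fun setT (fun z : R => m + s * z).
Proof. by apply: measurable_funD => //; apply: measurable_funM. Qed.

(** Both sides are measures agreeing on half-open intervals, which determine Lebesgue measure. *)
Lemma lebesgue_measure_affine (m s : R) (A : set R) : 0 < s -> measurable A ->
  mu A = (s%:E * mu ((fun z : R => m + s * z)%R @^-1` A))%E.
Proof.
move=> s0 mA.
have mphi := measurable_affine m s.
pose nu := mscale (NngNum (ltW s0)) (@image_measure R _ _ (measurableTypeR R)
  (measurableTypeR R) mu (fun z : R => m + s * z) mphi).
rewrite (@lebesgue_measure_unique R nu)//.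
move=> _ [[a b]] _ <-.
change (mu `]a, b] = s%:E * mu ((fun z : R => m + s * z)%R @^-1` `]a, b]))%E.
rewrite (_ : _ @^-1` _ = `]((a - m) / s), ((b - m) / s)]%classic); last first.
  apply/seteqP; split => z /=; rewrite !in_itv/=.
    by rewrite ltr_pdivrMr// ler_pdivlMr// ltrBlDl lerBrDl ![_ * s]mulrC.
  by rewrite ltr_pdivrMr// ler_pdivlMr// ltrBlDl lerBrDl ![_ * s]mulrC.
rewrite !lebesgue_measure_itv/= !lte_fin ltr_pM2r ?invr_gt0// ltrD2r.
case: ifP => ab; last by rewrite mule0.
by rewrite -!EFinD -EFinM; congr EFin; field; rewrite gt_eqF.
Qed.

Lemma normal_prob_affine (m s : R) (A : set R) : 0 < s -> measurable A ->
  normal_prob m s A = gauss ((fun z => m + s * z) @^-1` A).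
Proof.
move=> s0 mA.
have mphi := measurable_affine m s.
have mA' : measurable ((fun z : R => m + s * z) @^-1` A).
  by rewrite -[X in measurable X]setTI; exact: mphi.
rewrite /normal_prob.
pose nu0 := @image_measure R _ _ (measurableTypeR R) (measurableTypeR R)
  mu (fun z : R => m + s * z) mphi.
pose nu : {measure set (measurableTypeR R) -> \bar R} := mscale (NngNum (ltW s0)) nu0.
transitivity (\int[nu]_(x in A) (normal_pdf m s x)%:E)%E.
  apply: (@eq_measure_integral _ (measurableTypeR R) R A nu mu) => B mB _.
  exact: lebesgue_measure_affine.
rewrite /nu.
have mpdf : measurable_fun A (fun x => (normal_pdf m s x)%:E).
  by apply/measurable_EFinP; apply: measurable_funTS; exact: measurable_normal_pdf.
rewrite ge0_integral_mscale//; last by move=> x _; rewrite lee_fin normal_pdf_ge0.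
have nu0E : (\int[nu0]_(x in A) (normal_pdf m s x)%:E =
    \int[mu]_(z in (fun z : R => m + s * z)%R @^-1` A) (normal_pdf m s (m + s * z)%R)%:E)%E.
  apply: (@ge0_integral_pushforward _ _ (measurableTypeR R) (measurableTypeR R) R _
    mphi mu A _ mA mpdf).
  by move=> x _; rewrite lee_fin normal_pdf_ge0.
rewrite nu0E.
rewrite -ge0_integralZl//=; last 3 first.
- apply/measurable_EFinP/measurable_funTS.
  by apply: measurableT_comp => //; exact: measurable_normal_pdf.
- by move=> x _; rewrite lee_fin normal_pdf_ge0.
- exact: ltW.
apply: eq_integral => z _; rewrite -EFinM; congr EFin.
rewrite !normal_pdfE ?oner_neq0 ?gt_eqF//= /normal_fun /normal_peak mulrA.
congr (_ * expR _).
  rewrite -[s ^+ 2 * pi *+ 2]mulrnAr sqrtrM ?sqr_ge0// sqrtr_sqr gtr0_norm//.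
  by rewrite invfM mulrA mulfV ?gt_eqF// expr1n !mul1r.
have s1 : s != 0 by rewrite gt_eqF.
by rewrite -[s ^+ 2 *+ 2]mulr_natr -[1 ^+ 2 *+ 2]mulr_natr; field.
Qed.

(* The standard normal law pushed forward by z |-> m + sqrt v z is a Dirac mass
   when v = 0, so this form needs no case distinction. *)
Lemma normal_lawP (nu : set R -> \bar R) (m v : R) : normal_law nu m v <->
  0 <= v /\ forall A, measurable A ->
    nu A = gauss ((fun z => m + Num.sqrt v * z) @^-1` A).
Proof.
rewrite /normal_law; have [v0|v0 ] := ltP 0 v; last first.
  have [->|vn0] := eqVneq v 0; last first.
    by split=> -[v0']; exfalso; move/negP: vn0; apply; rewrite eq_le v0 v0'.
  rewrite sqrtr0.
  (* For zero variance the map is constant, so the preimage is everything or empty. *)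
  have gaussE A : gauss ((fun z => m + 0 * z) @^-1` A) = \d_m A.
    rewrite diracE; have [mA|mA] := boolP (m \in A).
      rewrite (_ : _ @^-1` _ = setT) ?probability_setT//.
      by apply/seteqP; split => // z _ /=; rewrite mul0r addr0; exact: set_mem.
    rewrite (_ : _ @^-1` _ = set0) ?measure0//.
    apply/seteqP; split => // z /=; rewrite mul0r addr0 => /mem_set.
    by rewrite (negPf mA).
  by split=> -[v0' H]; split=> // A mA; rewrite H// gaussE.
rewrite (gt_eqF v0); have s0 : 0 < Num.sqrt v by rewrite sqrtr_gt0.
split=> -[_ H]; (split; first exact: ltW) => A mA.
- by rewrite (H A mA) (normal_prob_affine m s0 mA).
- by rewrite (H A mA) -(normal_prob_affine m s0 mA).
Qed.

Section normal_random_variables.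
Context d (T : measurableType d) (P : probability T R).

Lemma normal_law_mgf (X : T -> R) (m v s : R) : measurable_fun setT X ->
  normal_law (pushforward P X) m v ->
  (\int[P]_w (expR (s * X w))%:E = (expR (s * m + s ^+ 2 * v / 2))%:E)%E.
Proof.
move=> mX /normal_lawP[v0 H].
have mexp : measurable_fun setT (fun x : R => (expR (s * x))%:E : \bar R).
  by apply/measurable_EFinP; apply: measurableT_comp => //; exact: measurable_funM.
have exp0 x : (0 <= (expR (s * x))%:E :> \bar R)%E by rewrite lee_fin expR_ge0.
have maff := measurable_affine m (Num.sqrt v).
have E1 := @eq_law_integral R _ _ _ R T (measurableTypeR R) P gauss X
  (fun z : R => m + Num.sqrt v * z) _ mX maff H mexp exp0.
have E2 := @ge0_integral_density _ (measurableTypeR R) mu gauss (normal_pdf 0 1) _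
  (measurable_normal_pdf 0 1) (normal_pdf_ge0 0 1) (fun _ _ => erefl)
  (measurableT_comp mexp maff) (fun z => exp0 _).
rewrite E1 {}E2.
set a := s * Num.sqrt v.
(* Completing the square: the exponential tilts the standard density into the one with mean
   [s * sqrt v], up to the announced constant. *)
have pdfE z : ((expR (s * (m + Num.sqrt v * z))%R)%:E * (normal_pdf 0 1 z)%:E =
    (expR (s * m + s ^+ 2 * v / 2)%R)%:E * (normal_pdf a 1 z)%:E)%E.
  rewrite -!EFinM; congr EFin; rewrite !normal_pdfE ?oner_neq0//= /normal_fun.
  rewrite mulrCA [RHS]mulrCA -!expRD; congr (_ * expR _).
  rewrite -[in RHS](sqr_sqrtr v0) -[1 ^+ 2 *+ 2]mulr_natr /a.
  by field.
under eq_integral do rewrite pdfE.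
rewrite ge0_integralZl//=; last 2 first.
- by apply/measurable_EFinP; exact: measurable_normal_pdf.
- by move=> x _; rewrite lee_fin normal_pdf_ge0.
by rewrite integral_normal_pdf mule1.
Qed.

Lemma normal_law_shift (X : T -> R) (c v : R) :
  normal_law (pushforward P X) 0 v -> normal_law (pushforward P (fun w => c + X w)) c v.
Proof.
move=> /normal_lawP[v0 H]; apply/normal_lawP; split=> // A mA.
have mA' : measurable ((fun x : R => c + x) @^-1` A).
  have mc : measurable_fun setT (fun x : R => c + x) by exact: measurable_funD.
  by rewrite -[X in measurable X]setTI; exact: mc.
transitivity (gauss ((fun z => 0 + Num.sqrt v * z) @^-1` ((fun x : R => c + x) @^-1` A))).
  exact: (H _ mA').
by congr (gauss _); apply/seteqP; split=> z /=; rewrite add0r.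
Qed.

(** On the Gaussian side the variables are [sqrt (u n) * z], which converge for every [z] by
    continuity of the square root; a limit of zero variance is included. *)
Lemma normal_law_limit (X : nat -> T -> R) (Y : T -> R) (u : nat -> R) (v : R) :
  (forall n, measurable_fun setT (X n)) -> measurable_fun setT Y ->
  {ae P, forall w, X n w @[n --> \oo] --> Y w} ->
  (forall n, normal_law (pushforward P (X n)) 0 (u n)) ->
  u n @[n --> \oo] --> v -> normal_law (pushforward P Y) 0 v.
Proof.
move=> mX mY cX nX cu; have v0 : 0 <= v.
  apply: (closed_cvg (fun x : R => 0 <= x)) cu; first exact: closed_ge.
  by apply: nearW => n; case: (nX n).
apply/normal_lawP; split => // A mA.
have mt d' (T' : measurableType d') (f : T' -> R) : measurable_fun setT f ->
    measurable_fun setT (fun w => [tuple f w] : 1.-tuple R).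
  move=> mf; apply/measurable_fun_tnthP => i.
  by rewrite (_ : _ \o _ = f)//; apply/funext => w /=; rewrite (ord1 i).
have mA' : measurable ((fun x : 1.-tuple R => tnth x ord0) @^-1` A).
  by rewrite -[X in measurable X]setTI; exact: measurable_tnth.
have [Poo goo] : (P setT < +oo)%E /\ (gauss setT < +oo)%E.
  by rewrite !probability_setT ltry.
have := @eq_law_limit R _ _ T (measurableTypeR R) 1 P gauss Poo goo
  (fun n w => [tuple X n w]) (fun n z => [tuple Num.sqrt (u n) * z])
  (fun w => [tuple Y w]) (fun z => [tuple Num.sqrt v * z]).
move=> /(_ _ _ _ _ _ _ _ _ mA').
rewrite /pushforward (_ : (fun z => 0 + _ * z) @^-1` A = (fun z => [tuple Num.sqrt v * z]) @^-1` ((fun x : 1.-tuple R => tnth x ord0) @^-1` A)); last first.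
  by apply/seteqP; split => z /=; rewrite add0r.
apply.
- by move=> n; exact: mt.
- by move=> n; apply: mt; exact: measurable_funM.
- exact: mt.
- by apply: mt; exact: measurable_funM.
- by apply: filterS cX => w cw i; rewrite (ord1 i).
- apply: nearW => z i; rewrite (ord1 i); apply: cvgMl.
  by apply: (cvg_comp _ _ cu); exact: sqrt_continuous.
- move=> n f [mf f01 cf].
  apply: (@eq_law_integral R _ _ _ _ T (measurableTypeR R) P gauss (X n) (fun z => Num.sqrt (u n) * z)
    (fun x => (f [tuple x])%:E)) => //.
  + exact: measurable_funM.
  + move=> B mB; have /normal_lawP[_ H] := nX n.
    transitivity (gauss ((fun z => 0 + Num.sqrt (u n) * z) @^-1` B)); first exact: (H _ mB).
    by congr (gauss _); apply/seteqP; split => z /=; rewrite add0r.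
  + apply/measurable_EFinP; apply: measurableT_comp => //.
    exact: mt.
  + by move=> x; rewrite lee_fin; have /andP[] := f01 [tuple x].
Qed.

End normal_random_variables.

End normal_laws.

(** * Independence and sub-sigma-algebras *)

Section independence.
Context {R : realType}.

Definition law d d' (T : measurableType d) (T' : measurableType d')
    (P : probability T R) (X : T -> T') (mX : measurable_fun setT X) : probability T' R :=
  let X' : {mfun T >-> T'} := HB.pack X (isMeasurableFun.Build _ _ _ _ X mX) in
  distribution P X'.

Context d (T : measurableType d) (P : probability T R).

Lemma probability_lty : (P setT < +oo)%E.
Proof. by rewrite probability_setT ltry. Qed.

Lemma independent_product_law d1 d2 (T1 : measurableType d1) (T2 : measurableType d2)
    (X : T -> T1) (Y : T -> T2) (mX : measurable_fun setT X) (mY : measurable_fun setT Y) :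
  (forall A B, measurable A -> measurable B ->
    P (X @^-1` A `&` Y @^-1` B) = (P (X @^-1` A) * P (Y @^-1` B))%E) ->
  forall C, measurable C ->
    P ((fun w => (X w, Y w)) @^-1` C) = (law P mX \x law P mY)%E C.
Proof.
move=> H C mC.
apply: (@eq_law_prod R _ _ _ _ T1 T2 T (T1 * T2)%type P (law P mX \x law P mY)%E
  (fun w => (X w, Y w)) id) => //.
- exact: probability_lty.
- exact: measurable_fun_pair.
- move=> A B mA mB; transitivity (law P mX A * law P mY B)%E; first exact: H.
  exact/esym/product_measure1E.
Qed.

Lemma independent_expectation (X Y : T -> R) (f g : R -> R) :
  measurable_fun setT X -> measurable_fun setT Y ->
  (forall A B, measurable A -> measurable B ->
    P (X @^-1` A `&` Y @^-1` B) = (P (X @^-1` A) * P (Y @^-1` B))%E) ->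
  measurable_fun setT f -> measurable_fun setT g ->
  (forall x, 0 <= f x) -> (forall x, 0 <= g x) ->
  (\int[P]_w (f (X w) * g (Y w))%:E = \int[P]_w (f (X w))%:E * \int[P]_w (g (Y w))%:E)%E.
Proof.
move=> mX mY H mf mg f0 g0.
pose h (z : R * R) := (f z.1 * g z.2)%:E.
have mh : measurable_fun setT h.
  apply/measurable_EFinP; apply: measurable_funM.
    exact: (measurableT_comp mf measurable_fst).
  exact: (measurableT_comp mg measurable_snd).
have h0 z : (0 <= h z)%E by rewrite lee_fin mulr_ge0.
have E1 := @eq_law_integral R _ _ _ (R * R)%type T (R * R)%type P (law P mX \x law P mY)%E
  (fun w => (X w, Y w)) id h (measurable_fun_pair mX mY) (@measurable_id _ _ setT)
  (independent_product_law mX mY H) mh h0.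
have EF : forall Z (mZ : measurable_fun setT Z) (k : R -> R), measurable_fun setT k ->
    (forall x, 0 <= k x) -> (\int[law P mZ]_x (k x)%:E = \int[P]_w (k (Z w))%:E)%E.
  move=> Z mZ k mk k0.
  apply: (@ge0_integral_pushforward _ _ _ _ _ _ mZ P setT (EFin \o k)) => //.
  - exact/measurable_EFinP.
  - by move=> x _; rewrite lee_fin.
rewrite [LHS]E1 fubini_tonelli1// /fubini_F/= /h/=.
under eq_integral => x _.
  under eq_integral do rewrite EFinM.
  rewrite ge0_integralZl//; last 3 first.
  - exact/measurable_EFinP.
  - by move=> y _; rewrite lee_fin.
  - by rewrite lee_fin.
  rewrite EF//.
  over.
rewrite ge0_integralZr//; last 3 first.
- exact/measurable_EFinP.
- by move=> y _; rewrite lee_fin.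
- by apply: integral_ge0 => w _; rewrite lee_fin.
by rewrite EF.
Qed.

End independence.

Section sub_sigma_algebras.
Context d (T : measurableType d) (G : set (set T)).
Hypothesis sG : sigma_algebra setT G.

(** A member of a filtration is a bare family of sets. Being a sigma-algebra already, it equals the
    one it generates, which gives access to measurability with respect to it. *)
Lemma measurable_fun_subP d' (E : measurableType d') (f : T -> E) :
  @measurable_fun _ _ (g_sigma_algebraType G) E setT f <->
  preimage_set_system setT f measurable `<=` G.
Proof.
have GE : <<s G >> = G by exact: sigma_algebra_id.
split=> [mf _ [A mA <-]|mf _ A mA].
  by rewrite -GE; exact: mf.
by apply: sub_sigma_algebra; apply: mf; exists A.
Qed.

Lemma sigma_algebra_setI (A B : set T) : G A -> G B -> G (A `&` B).
Proof.
have GE : <<s G >> = G by exact: sigma_algebra_id.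
by rewrite -GE; exact: (@measurableI _ (g_sigma_algebraType G)).
Qed.

End sub_sigma_algebras.

(** * Sums of Brownian increments and Wiener integrals *)

Section increment_sums.
Context {R : realType} d (T : measurableType d) (P : probability T R).
Variables (F : R -> set (set T)) (m : nat) (C : 'M[R]_m) (W : R -> T -> m.-tuple R).
Hypotheses (hF : filtration F) (hW : brownian_motion P F C W).
Hypothesis hG : gaussian_process P W.
Variables (s : nat -> R) (s_0 : s 0%N = 0) (s_leS : forall k, s k <= s k.+1).
Variables (p : nat) (a : 'I_p -> nat -> R) (c : 'I_p -> 'I_m).

Let F_sigma t : 0 <= t -> sigma_algebra setT (F t).
Proof. by case: hF => + _ _; exact. Qed.

Let F_measurable t : 0 <= t -> F t `<=` measurable.
Proof. by case: hF => _ + _; exact. Qed.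

Let F_mono u t : 0 <= u -> u <= t -> F u `<=` F t.
Proof. by case: hF => _ _; exact. Qed.

Lemma partition_ge0 k : 0 <= s k.
Proof. by elim: k => [|k IH]; [rewrite s_0|exact: le_trans (s_leS k)]. Qed.

(** Coordinate [i] integrates a step function against component [c i] of [W]; several coordinates
    may share a driver. *)
Definition increment_sum k (w : T) : p.-tuple R :=
  [tuple \sum_(0 <= j < k) a i j * tnth (increment W (s j) (s j.+1) w) (c i) | i < p].

(** The next sum as a function of the current one, measurable for [F (s k)], and of the next
    increment, independent of [F (s k)]. *)
Definition increment_step k (z : p.-tuple R * m.-tuple R) : p.-tuple R :=
  [tuple tnth z.1 i + a i k * tnth z.2 (c i) | i < p].

Lemma increment_sumS k w : increment_sum k.+1 w =
  increment_step k (increment_sum k w, increment W (s k) (s k.+1) w).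
Proof.
apply: eq_from_tnth => i; rewrite [LHS]tnth_mktuple [RHS]tnth_mktuple.
by rewrite [X in _ = X + _]tnth_mktuple big_nat_recr.
Qed.

Lemma measurable_increment_step k : measurable_fun setT (increment_step k).
Proof.
apply/measurable_fun_tnthP => i.
rewrite (_ : _ \o _ = fun z => tnth z.1 i + a i k * tnth z.2 (c i)); last first.
  by apply/funext => z /=; rewrite tnth_mktuple.
apply: measurable_funD.
  exact: (measurableT_comp (@measurable_tnth _ R p i) measurable_fst).
apply: measurable_funM => //.
exact: (measurableT_comp (@measurable_tnth _ R m (c i)) measurable_snd).
Qed.

Lemma adapted_sub u t : 0 <= u -> u <= t ->
  @measurable_fun _ _ (g_sigma_algebraType (F t)) (m.-tuple R) setT (W u).
Proof.
move=> u0 ut; have t0 := le_trans u0 ut.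
apply/(measurable_fun_subP (F_sigma t0)).
case: hW => aW _ _ _ _; exact: subset_trans (aW _ u0) (F_mono u0 ut).
Qed.

Lemma measurable_increment_sub u u' t : 0 <= u -> u <= u' -> u' <= t ->
  @measurable_fun _ _ (g_sigma_algebraType (F t)) (m.-tuple R) setT (increment W u u').
Proof.
move=> u0 uu' ut; apply/measurable_fun_tnthP => i.
rewrite (_ : _ \o _ = fun w => tnth (W u' w) i - tnth (W u w) i); last first.
  by apply/funext => w /=; rewrite tnth_mktuple.
apply: measurable_funB.
  apply: (measurableT_comp (@measurable_tnth _ R m i)).
  by apply: adapted_sub => //; exact: le_trans uu'.
apply: (measurableT_comp (@measurable_tnth _ R m i)).
by apply: adapted_sub => //; exact: le_trans ut.
Qed.

Lemma measurable_increment_sum_sub k :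
  @measurable_fun _ _ (g_sigma_algebraType (F (s k))) (p.-tuple R) setT (increment_sum k).
Proof.
elim: k => [|k IH].
  rewrite (_ : increment_sum 0 = fun=> [tuple 0 | _ < p]); first exact: measurable_cst.
  by apply/funext => w; apply: eq_from_tnth => i; rewrite !tnth_mktuple big_geq.
rewrite (_ : increment_sum k.+1 = increment_step k \o
    (fun w => (increment_sum k w, increment W (s k) (s k.+1) w))); last first.
  by apply/funext => w /=; rewrite increment_sumS.
apply: (measurableT_comp (measurable_increment_step k)).
apply: measurable_fun_pair; last first.
  by apply: measurable_increment_sub => //; exact: partition_ge0.
apply/(measurable_fun_subP (F_sigma (partition_ge0 k.+1))).
move/(measurable_fun_subP (F_sigma (partition_ge0 k))) : IH.
move=> /subset_trans; apply; apply: F_mono => //; exact: partition_ge0.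
Qed.

Lemma measurable_of_sub d' (E : measurableType d') t (f : T -> E) : 0 <= t ->
  @measurable_fun _ _ (g_sigma_algebraType (F t)) E setT f -> measurable_fun setT f.
Proof.
move=> t0 /(measurable_fun_subP (F_sigma t0)) fF _ A mA.
by apply: (F_measurable t0); apply: fF; exists A.
Qed.

Lemma measurable_increment_sum k : measurable_fun setT (increment_sum k).
Proof.
apply: (@measurable_of_sub _ (p.-tuple R) (s k)); first exact: partition_ge0.
exact: measurable_increment_sum_sub.
Qed.

Lemma measurable_increment u u' : 0 <= u -> u <= u' ->
  measurable_fun setT (increment W u u').
Proof.
move=> u0 uu'; apply: (@measurable_of_sub _ (m.-tuple R) u'); first exact: le_trans uu'.
exact: measurable_increment_sub.
Qed.

Lemma increment_independent k A B : F (s k) A -> measurable B ->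
  P (A `&` increment W (s k) (s k.+1) @^-1` B) =
    (P A * P (increment W (s k) (s k.+1) @^-1` B))%E.
Proof.
case: hW => _ _ _ iW _ FA mB; apply: (iW _ _ (partition_ge0 k) (s_leS k)) => //.
by exists B => //; rewrite setTI.
Qed.

Lemma increment_sum_sub k B : measurable B -> F (s k) (increment_sum k @^-1` B).
Proof.
have /(measurable_fun_subP (F_sigma (partition_ge0 k))) H := @measurable_increment_sum_sub k.
by move=> mB; apply: H; exists B => //; rewrite setTI.
Qed.

(** Independence of [A] means equal laws under [P] restricted to [A] and under [P A] times [P]. In
    the induction this is checked on rectangles for the pair formed by the current sum and the next
    increment. *)
Lemma increment_sum_independent k A B : F 0 A -> measurable B ->
  P (A `&` increment_sum k @^-1` B) = (P A * P (increment_sum k @^-1` B))%E.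
Proof.
move=> FA; have mA : measurable A by exact: F_measurable FA.
have FsA j : F (s j) A by apply: F_mono FA => //; exact: partition_ge0.
elim: k B => [|k IH] B mB.
  have [] : increment_sum 0 @^-1` B = setT \/ increment_sum 0 @^-1` B = set0.
    have E w : increment_sum 0 w = [tuple 0 | _ < p].
      by apply: eq_from_tnth => i; rewrite !tnth_mktuple big_geq.
    have [BE|BE] := pselect (B [tuple 0 | _ < p]).
      by left; apply/seteqP; split => w //= _; rewrite E.
    by right; apply/seteqP; split => w //=; rewrite E.
  - by move=> ->; rewrite setIT probability_setT mule1.
  - by move=> ->; rewrite setI0 measure0 mule0.
have PA : (P A)%E = (fine (P A))%:E by rewrite fineK// fin_num_measure.
have PA0 : 0 <= fine (P A) by rewrite fine_ge0.
pose m1 : {measure set T -> \bar R} := mrestr P mA.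
pose m2 : {measure set T -> \bar R} := mscale (NngNum PA0) P.
have mV : measurable_fun setT (fun w => (increment_sum k w, increment W (s k) (s k.+1) w)).
  apply: measurable_fun_pair; first exact: measurable_increment_sum.
  exact: measurable_increment (partition_ge0 k) (s_leS k).
have m1oo : (m1 setT < +oo)%E.
  by rewrite /m1/= /mrestr/= setTI PA ltry.
have mB' : measurable (increment_step k @^-1` B).
  by rewrite -[X in measurable X]setTI; exact: measurable_increment_step.
have := @eq_law_prod R _ _ _ _ (p.-tuple R) (m.-tuple R) T T m1 m2
  (fun w => (increment_sum k w, increment W (s k) (s k.+1) w)) _ m1oo mV mV _ _ mB'.
have E : (fun w => (increment_sum k w, increment W (s k) (s k.+1) w)) @^-1`
    (increment_step k @^-1` B) = increment_sum k.+1 @^-1` B.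
  by apply/seteqP; split => w /=; rewrite increment_sumS.
rewrite E /m1 /m2 /= /mrestr /mscale/= -PA setIC; apply => B1 B2 mB1 mB2.
rewrite (_ : _ @^-1` _ = increment_sum k @^-1` B1 `&` increment W (s k) (s k.+1) @^-1` B2)//.
(* The next increment is split off twice: here from [A] intersected with an event of the sum, which
   lies in [F (s k)], and below from the event of the sum alone. *)
rewrite setIC setIA increment_independent//; last first.
  apply: (sigma_algebra_setI (F_sigma (partition_ge0 k))); first exact: FsA.
  exact: increment_sum_sub.
rewrite IH// increment_independent//; last exact: increment_sum_sub.
by rewrite muleA.
Qed.

Section linear_functional.
Variable u : 'rV[R]_p.

Definition increment_form k (w : T) : R := \sum_i u 0 i * tnth (increment_sum k w) i.

(** Coefficients are collected by driver, so the linear form becomes a functional of the increment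
    of [W] itself. *)
Definition step_row k : 'rV[R]_m := \row_l \sum_(i | c i == l) u 0 i * a i k.

Definition form_variance k : R :=
  \sum_(0 <= j < k) (s j.+1 - s j) * (step_row j *m C *m (step_row j)^T) 0 0.

Lemma step_rowE k (z : 'I_m -> R) :
  \sum_l step_row k 0 l * z l = \sum_i u 0 i * (a i k * z (c i)).
Proof.
rewrite [RHS](partition_big c xpredT)//=; apply: eq_bigr => l _.
by rewrite mxE mulr_suml; apply: eq_bigr => i /eqP <-; rewrite mulrA.
Qed.

Lemma step_row_variance k : (step_row k *m C *m (step_row k)^T) 0 0 =
  \sum_i \sum_j u 0 i * u 0 j * C (c j) (c i) * (a i k * a j k).
Proof.
rewrite mxE; under eq_bigr do rewrite [_^T _ _]mxE mulrC.
rewrite step_rowE; apply: eq_bigr => i _.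
rewrite [(_ *m _) 0 _]mxE step_rowE !mulr_sumr; apply: eq_bigr => j _.
by ring.
Qed.

Lemma increment_formS k w : increment_form k.+1 w = increment_form k w +
  \sum_l step_row k 0 l * tnth (increment W (s k) (s k.+1) w) l.
Proof.
rewrite step_rowE -big_split/=; apply: eq_bigr => i _.
by rewrite increment_sumS tnth_mktuple -mulrDr.
Qed.

Lemma increment_form0 w : increment_form 0 w = 0.
Proof. by rewrite /increment_form big1// => i _; rewrite tnth_mktuple big_geq// mulr0. Qed.

Lemma measurable_linear_form n (v : 'I_n -> R) :
  measurable_fun setT (fun x : n.-tuple R => \sum_i v i * tnth x i).
Proof.
apply: measurable_sum => i; apply: measurable_funM => //; exact: measurable_tnth.
Qed.

Lemma measurable_increment_form k : measurable_fun setT (increment_form k).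
Proof.
exact: (measurableT_comp (measurable_linear_form (u 0)) (@measurable_increment_sum k)).
Qed.

(** Successive increments are independent of the past and centred normal, so their generating
    functions multiply and their variances add. *)
Lemma increment_form_mgf k r :
  (\int[P]_w (expR (r * increment_form k w))%:E = (expR (r ^+ 2 * form_variance k / 2))%:E)%E.
Proof.
elim: k => [|k IH].
  under eq_integral do rewrite increment_form0 mulr0 expR0.
  rewrite integral_cst// mul1e /form_variance big_geq// mulr0 mul0r expR0.
  exact: probability_setT.
pose Y w := \sum_l step_row k 0 l * tnth (increment W (s k) (s k.+1) w) l.
have mY : measurable_fun setT Y.
  apply: (measurableT_comp (measurable_linear_form (step_row k 0))).
  exact: measurable_increment (partition_ge0 k) (s_leS k).
have nY : normal_law (pushforward P Y) 0
    ((s k.+1 - s k) * (step_row k *m C *m (step_row k)^T) 0 0).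
  case: hW => _ _ _ _ nW; have [_ /(_ (step_row k))] := nW _ _ (partition_ge0 k) (s_leS k).
  rewrite (_ : \sum_i _ = 0); last by rewrite big1// => i _; rewrite tnth_mktuple mulr0.
  by rewrite -scalemxAr -scalemxAl mxE.
under eq_integral do rewrite increment_formS mulrDr expRD.
have mexp : measurable_fun setT (fun x : R => expR (r * x)).
  by apply: measurableT_comp => //; exact: measurable_funM.
rewrite (@independent_expectation R _ _ P (increment_form k) Y (fun x => expR (r * x))
  (fun x => expR (r * x)))//; last 2 first.
- exact: measurable_increment_form.
- move=> A B mA mB.
  have mA' : measurable ((fun x : p.-tuple R => \sum_i u 0 i * tnth x i) @^-1` A).
    by rewrite -[X in measurable X]setTI; exact: (measurable_linear_form (u 0)).
  have mB' : measurable ((fun x : m.-tuple R => \sum_l step_row k 0 l * tnth x l) @^-1` B).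
    by rewrite -[X in measurable X]setTI; exact: (measurable_linear_form (step_row k 0)).
  exact: (@increment_independent k _ _ (@increment_sum_sub k _ mA') mB').
rewrite IH (normal_law_mgf r mY nY) -EFinM -expRD; congr (expR _)%:E.
by rewrite /form_variance big_nat_recr//= mulr0 add0r; ring.
Qed.

Lemma increment_form_gaussian k : exists mean v,
  normal_law (pushforward P (increment_form k)) mean v.
Proof.
(* Joint Gaussianity concerns values of [W], so each increment is spelled as two of them: right ends
   in the first half of the indices, left ends with opposite sign in the second. *)
pose tau (j : 'I_(k + k)) := match fintype.split j with inl l => s l.+1 | inr l => s l end.
pose coef (j : 'I_(k + k)) (i : 'I_m) :=
  match fintype.split j with inl l => step_row l 0 i | inr l => - step_row l 0 i end.
have [|mean [v H]] := hG (s := tau) coef.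
  by move=> j; rewrite /tau; case: fintype.split => l; exact: partition_ge0.
exists mean, v; rewrite (_ : increment_form k = fun w =>
  \sum_j \sum_i coef j i * tnth (W (tau j) w) i)//.
apply/funext => w; rewrite big_split_ord/= /coef /tau.
have splitl (l : 'I_k) : fintype.split (lshift k l) = inl l := unsplitK (inl l).
have splitr (l : 'I_k) : fintype.split (rshift k l) = inr l := unsplitK (inr l).
under eq_bigr do rewrite splitl.
under [X in _ = _ + X]eq_bigr do rewrite splitr.
rewrite -big_split/= {H splitl splitr tau coef}.
elim: k => [|k IH]; first by rewrite increment_form0 big_ord0.
rewrite increment_formS big_ord_recr/= IH; congr (_ + _).
rewrite -big_split/=; apply: eq_bigr => l _.
by rewrite tnth_mktuple mulrBr mulNr.
Qed.

(* Gaussianity is assumed, so the moment generating function at 1 and -1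
   suffices to identify the two parameters. *)
Lemma increment_form_normal k :
  normal_law (pushforward P (increment_form k)) 0 (form_variance k).
Proof.
have [mean [v H]] := increment_form_gaussian k.
have mf := measurable_increment_form k.
have := increment_form_mgf k 1; have := increment_form_mgf k (-1).
rewrite !(normal_law_mgf _ mf H) => -[/expR_inj E1] [/expR_inj E2].
have m0 : mean = 0 by lra.
have -> : form_variance k = v by lra.
by rewrite -m0.
Qed.

End linear_functional.

End increment_sums.

(** * Wiener integrals as almost sure limits of increment sums *)

Section wiener_integrals.
Context {R : realType} d (T : measurableType d) (P : probability T R).
Variables (F : R -> set (set T)) (m : nat) (C : 'M[R]_m) (W : R -> T -> m.-tuple R).
Hypotheses (hF : filtration F) (hW : brownian_motion P F C W).
Hypothesis hG : gaussian_process P W.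
Variables (t : R) (t0 : 0 <= t) (p : nat) (g : 'I_p -> R -> R) (c : 'I_p -> 'I_m).
Variables (b : 'I_p -> R) (N : T -> p.-tuple R).
Hypothesis cg : forall i, continuous (g i).
Hypothesis mN : measurable_fun setT N.

Let V n := increment_sum W (mesh_point t n)
  (fun i k => b i * g i (mesh_point t n k)) c n.+1.

Hypothesis cV : {ae P, forall w, forall i, tnth (V n w) i @[n --> \oo] --> tnth (N w) i}.

Let s0 n : mesh_point t n 0 = 0. Proof. exact: mesh_point0. Qed.
Let sS n k : mesh_point t n k <= mesh_point t n k.+1. Proof. exact: mesh_point_leS. Qed.

Let mV n : measurable_fun setT (V n).
Proof. exact: (measurable_increment_sum hF hW (s0 n) (sS n)). Qed.

Lemma wiener_integral_independent A B : F 0 A -> measurable B ->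
  P (A `&` N @^-1` B) = (P A * P (N @^-1` B))%E.
Proof.
move=> FA mB; have mA : measurable A by case: hF => _ /(_ 0 (lexx 0) _ FA).
have PA : (P A)%E = (fine (P A))%:E by rewrite fineK// fin_num_measure.
have PA0 : 0 <= fine (P A) by rewrite fine_ge0.
pose m1 : {measure set T -> \bar R} := mrestr P mA.
pose m2 : {measure set T -> \bar R} := mscale (NngNum PA0) P.
have m1E D : m1 D = P (A `&` D) by rewrite setIC.
have m2E D : m2 D = (P A * P D)%E by rewrite PA.
have m1oo : (m1 setT < +oo)%E by rewrite m1E setIT PA ltry.
have m2oo : (m2 setT < +oo)%E by rewrite m2E probability_setT mule1 PA ltry.
rewrite -m1E -m2E; apply: (@eq_law_limit R _ _ T T p m1 m2 m1oo m2oo V V N N) => //.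
- case: cV => D [mD D0 sD]; exists D; split => //; rewrite m1E.
  by apply: (subset_measure0 _ mD) => //; exact: measurableI.
- case: cV => D [mD D0 sD]; exists D; split => //; rewrite m2E.
  by rewrite [P D]D0 mule0.
- move=> n f [mf f01 _].
  apply: (@eq_law_integral R _ _ _ _ T T m1 m2 (V n) (V n) (fun x => (f x)%:E)) => //.
  + move=> D mD; rewrite m1E m2E.
    exact: (increment_sum_independent hF hW (s0 n) (sS n)).
  + exact/measurable_EFinP.
  + by move=> x; rewrite lee_fin; have /andP[] := f01 x.
Qed.

Lemma wiener_integral_normal (u : 'rV[R]_p) :
  normal_law (pushforward P (fun w => \sum_i u 0 i * tnth (N w) i)) 0
    (\sum_i \sum_j u 0 i * u 0 j * (b i * b j * C (c j) (c i) *
       \int[lebesgue_measure]_(s in `[0, t]) (g i s * g j s))).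
Proof.
pose a n (i : 'I_p) k := b i * g i (mesh_point t n k).
apply: (@normal_law_limit R _ T P (fun n => increment_form W (mesh_point t n) (a n) c u n.+1)
  _ (fun n => form_variance C (mesh_point t n) (a n) c u n.+1)).
- by move=> n; exact: (measurable_increment_form hF hW (s0 n) (sS n)).
- exact: (measurableT_comp (measurable_linear_form (u 0)) mN).
- apply: filterS cV => w cw; rewrite /increment_form.
  by apply: cvg_big => [|i _]; [exact: add_continuous|apply: cvgMr; exact: cw].
- by move=> n; exact: (increment_form_normal hF hW hG (s0 n) (sS n)).
(* The variance of the sum is a combination of Riemann sums of [g i * g j], with both factors at
   left end points. *)
- have E n : form_variance C (mesh_point t n) (a n) c u n.+1 =
      \sum_i \sum_j u 0 i * u 0 j * (b i * b j * C (c j) (c i) *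
       \sum_(0 <= k < n.+1) mesh t n * (g i (mesh_point t n k) * g j (mesh_point t n k))).
    rewrite /form_variance.
    under eq_bigr do rewrite mesh_pointS step_row_variance mulr_sumr.
    rewrite exchange_big/=; apply: eq_bigr => i _.
    under eq_bigr do rewrite mulr_sumr.
    rewrite exchange_big/=; apply: eq_bigr => j _.
    rewrite !mulr_sumr; apply: eq_bigr => k _; rewrite /a; ring.
  under eq_fun do rewrite E.
  apply: cvg_big => [|i _]; first exact: add_continuous.
  apply: cvg_big => [|j _]; first exact: add_continuous.
  do 2 apply: cvgMr; apply: riemann_sum_cvg => //; exact: mesh_tags.
Qed.

End wiener_integrals.

(** * Linear equations with constant volatility *)

Section linear_sde.
Context {R : realType}.
Local Notation mu := (@lebesgue_measure R).

(** Paths are continuous on the half-line, while the Riemann sum lemmas ask for continuity on [R];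
    freezing the path at its value at 0 reconciles the two. *)
Lemma continuous_path_extend (f : R -> R) : continuous_path f ->
  continuous (fun s : R => f (Num.max 0 s)).
Proof.
move=> /subspace_continuousP cf s.
have A0 (x : R) : `[0, +oo[%classic (Num.max 0 x).
  by rewrite /= in_itv /= andbT le_max lexx.
have cmax : {for s, continuous ((cst 0 : R -> R^o) \max (fun x : R => x : R^o))}.
  by apply: continuous_max; [exact: cvg_cst|exact: cvg_id].
move=> U /(cf _ (A0 s)) HU.
have : \forall x \near (s : R), `[0, +oo[%classic (Num.max 0 x) ->
  (f @^-1` U) (Num.max 0 x) by exact: (cmax _ HU).
by apply: filterS => x /(_ (A0 x)).
Qed.

Lemma Rintegral_extend (f : R -> R) (t : R) :
  \int[mu]_(s in `[0, t]) f s = \int[mu]_(s in `[0, t]) f (Num.max 0 s).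
Proof.
apply: eq_Rintegral => s; rewrite inE/= in_itv/= => /andP[s0 _].
by rewrite max_r.
Qed.

Context d (T : measurableType d) (P : probability T R).

Lemma measurable_time_integral (X : R -> T -> R) (t : R) : 0 <= t ->
  (forall s, 0 <= s -> measurable_fun setT (X s)) ->
  (forall w, continuous_path (X ^~ w)) ->
  measurable_fun setT (fun w => \int[mu]_(s in `[0, t]) X s w).
Proof.
move=> t0 mX cX.
apply: (@measurable_fun_cvg _ _ _ setT (fun n w =>
  \sum_(0 <= k < n.+1) mesh t n * (X (mesh_point t n k) w * 1))).
  move=> n; apply: measurable_sum => k; apply: measurable_funM => //.
  by apply: measurable_funM => //; apply: mX; exact: mesh_point_ge0.
move=> w _; have cf := continuous_path_extend (cX w).
have := riemann_sum_cvg t0 cf (@cst_continuous _ _ (1 : R)) (mesh_tags t0) (mesh_tags t0).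
have <- : \int[mu]_(s in `[0, t]) (X (Num.max 0 s) w * 1) = \int[mu]_(s in `[0, t]) X s w.
  by rewrite [RHS]Rintegral_extend; apply: eq_Rintegral => s _; rewrite mulr1.
move=> H; apply: cvg_trans H; apply: near_eq_cvg; apply: nearW => n.
by apply: eq_bigr => k _; rewrite max_r// mesh_point_ge0.
Qed.

(** The same [eps] bounds size and probability: shrinking it below a fixed level shows that this
    level is exceeded with probability 0. *)
Lemma ae_eq_small_probability (D : T -> R) : measurable_fun setT D ->
  (forall eps, 0 < eps -> (P [set w | (eps <= `|D w|)%R] <= eps%:E)%E) ->
  {ae P, forall w, D w = 0}.
Proof.
move=> mD H.
have mE e : measurable [set w | e <= `|D w|].
  have mDn : measurable_fun setT (fun w => `|D w|) by exact: measurableT_comp.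
  have := mDn measurableT `[e, +oo[%classic (measurable_itv _).
  rewrite setTI; congr measurable; apply/seteqP.
  by split => w /=; rewrite in_itv/= andbT.
have P0 n : P [set w | n.+1%:R^-1 <= `|D w|] = 0%E.
  apply/eqP; rewrite eq_le measure_ge0 andbT; apply/lee_addgt0Pr => e e0.
  rewrite add0e; set e' := Num.min e n.+1%:R^-1.
  have e'0 : 0 < e' by rewrite lt_min e0 invr_gt0 ltr0n.
  apply: (@le_trans _ _ (P [set w | e' <= `|D w|])).
    apply: le_measure; rewrite ?inE//; move=> w /=; apply: le_trans.
    by rewrite ge_min lexx orbT.
  by apply: (le_trans (H _ e'0)); rewrite lee_fin ge_min lexx.
have : {ae P, forall w, forall n, `|D w| < n.+1%:R^-1}.
  apply: ae_foralln => n; exists [set w | n.+1%:R^-1 <= `|D w|].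
  split; [exact: mE|exact: P0|move=> w /=].
  by move/negP; rewrite -leNgt.
apply: filterS => w Dw; apply: contrapT => /eqP; rewrite -normr_gt0 => Dw0.
have [n _ Hn] := near_infty_natSinv_lt (PosNum Dw0).
by have := Hn n (leqnn n); rewrite /= ltNge ltW.
Qed.

(** The left-point sums telescope to a variable independent of the partition, so their convergence
    in probability is an almost sure equality. *)
Lemma ito_integral_cst (sigma t : R) (W : R -> T -> R) (Z : T -> R) : 0 <= t ->
  (forall s, 0 <= s -> measurable_fun setT (W s)) -> measurable_fun setT Z ->
  ito_integral P (fun _ _ => sigma) W t Z ->
  {ae P, forall w, Z w = sigma * (W t w - W 0 w)}.
Proof.
move=> t0 mW mZ HZ.
have mD : measurable_fun setT (fun w => sigma * (W t w - W 0 w) - Z w).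
  apply: measurable_funB => //; apply: measurable_funM => //.
  by apply: measurable_funB; exact: mW.
have := ae_eq_small_probability mD; move=> H.
have : {ae P, forall w, sigma * (W t w - W 0 w) - Z w = 0}.
  apply: H => eps eps0; have [delta delta0 Hd] := HZ eps eps0.
  have /cvgrPdist_lt/(_ _ delta0)[n _ Hn] := @mesh_cvg0 R t.
  have := Hn n (leqnn n); rewrite /= sub0r normrN ger0_norm ?mesh_ge0// => hd.
  have := Hd n.+1 (mesh_point t n) (mesh_point0 t n) (mesh_pointT t n).
  have step k : (k < n.+1)%N -> mesh_point t n k <= mesh_point t n k.+1 /\
      mesh_point t n k.+1 - mesh_point t n k < delta.
    by move=> _; rewrite mesh_pointS mesh_point_leS.
  move=> /(_ step); congr (P _ <= _)%E; apply/seteqP.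
  have E w : \sum_(0 <= k < n.+1) sigma *
      (W (mesh_point t n k.+1) w - W (mesh_point t n k) w) = sigma * (W t w - W 0 w).
    rewrite -mulr_sumr (@telescope_sumr _ 0%N n.+1 (fun k => W (mesh_point t n k) w))//.
    by rewrite mesh_pointT mesh_point0.
  by split => w /=; rewrite E.
by apply: filterS => w /eqP; rewrite subr_eq0 => /eqP ->.
Qed.

Section vasicek.
Variables (F : R -> set (set T)) (X W : R -> T -> R) (kappa xbar sigma : R).
Hypothesis hF : filtration F.
Hypothesis hX : sde_solution P F X (fun s w => kappa * (xbar - X s w))
  (fun _ _ => sigma) W.
Hypothesis mW : forall s, 0 <= s -> measurable_fun setT (W s).

Let J s w := \int[mu]_(u in `[0, s]) X u w.

Lemma measurable_sde_solution s : 0 <= s -> measurable_fun setT (X s).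
Proof.
move=> s0; case: hF => sF mF _; apply: (measurable_of_sub hF s0).
apply/(measurable_fun_subP (sF s s0)).
by case: hX => aX _ _; exact: aX.
Qed.

Lemma measurable_sde_integral s : 0 <= s -> measurable_fun setT (J s).
Proof.
move=> s0; apply: measurable_time_integral => //; first exact: measurable_sde_solution.
by case: hX.
Qed.

Let cX w : continuous (fun s : R => X (Num.max 0 s) w).
Proof. by case: hX => _ cX _; exact: (@continuous_path_extend (X ^~ w) (cX w)). Qed.

Lemma vasicek_driftE s w : 0 <= s ->
  \int[mu]_(u in `[0, s]) (kappa * (xbar - X u w)) = kappa * (xbar * s - J s w).
Proof.
move=> s0; rewrite (Rintegral_extend (fun u => kappa * (xbar - X u w))).
have ic : mu.-integrable `[0, s] (EFin \o (fun=> xbar)).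
  by apply: continuous_integrable_itv; exact: cst_continuous.
have iX := continuous_integrable_itv 0 s (@cX w).
rewrite RintegralZl//; last first.
  apply: (@continuous_integrable_itv R (fun u => xbar - X (Num.max 0 u) w)).
  by move=> u; apply: cvgB; [exact: cvg_cst|exact: cX].
have Ec : \int[mu]_(u in `[0, s]) xbar = xbar * s.
  have D (u : R) : is_derive u 1 (fun u : R => xbar * u) xbar.
    have H := is_derive_fun_mul (is_derive_fun_cst xbar u) (is_derive_fun_id u).
    by apply: (is_derive_eq1 H); rewrite mulr1 mulr0 addr0.
  have cc : continuous (fun _ : R => xbar) by exact: cst_continuous.
  by rewrite (Rintegral_primitive s0 cc D) mulr0 subr0.
by rewrite RintegralB// Ec /J (Rintegral_extend (X ^~ w)).
Qed.

Lemma vasicek_ae s : 0 <= s -> {ae P, forall w,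
  sigma * (W s w - W 0 w) = X s w - X 0 w - kappa * (xbar * s - J s w)}.
Proof.
move=> s0; case: (hX) => _ _ /(_ s s0) HI.
have mZ : measurable_fun setT (fun w => X s w - X 0 w - kappa * (xbar * s - J s w)).
  apply: measurable_funB.
    by apply: measurable_funB; exact: measurable_sde_solution.
  apply: measurable_funM => //; apply: measurable_funB => //.
  exact: measurable_sde_integral.
have HI' : ito_integral P (fun _ _ => sigma) W s
    (fun w => X s w - X 0 w - kappa * (xbar * s - J s w)).
  move: HI; congr (ito_integral P _ W s _); apply/funext => w.
  by rewrite vasicek_driftE.
by have := ito_integral_cst s0 mW mZ HI'; apply: filterS => w ->.
Qed.

(** The null set of [vasicek_ae] depends on the time; countably many mesh points leave a single
    one. *)
Lemma vasicek_mesh_ae t : 0 <= t -> {ae P, forall w, forall n k,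
  let p := mesh_point t n k in let q := mesh_point t n k.+1 in
  sigma * (W q w - W p w) =
    X q w - X p w - kappa * (xbar * mesh t n - (J q w - J p w))}.
Proof.
move=> t0; apply: ae_foralln => n; apply: ae_foralln => k.
have := vasicek_ae (mesh_point_ge0 n k t0); have := vasicek_ae (mesh_point_ge0 n k.+1 t0).
apply: filterS2 => w Eq Ep /=; rewrite -(mesh_pointS t n k).
rewrite (_ : W _ w - W _ w = W (mesh_point t n k.+1) w - W 0 w -
  (W (mesh_point t n k) w - W 0 w)); last by ring.
by rewrite mulrBr Eq Ep; ring.
Qed.

(* The integrands g(s) = e^(-kappa (t - s)) and g(s) = Psi(kappa, t - s) satisfy
   g' = kappa g - c with c = 0 and c = 1. *)
Lemma vasicek_cvg t : 0 <= t -> {ae P, forall w,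
  sigma * (\sum_(0 <= k < n.+1) expR (- (kappa * (t - mesh_point t n k))) *
     (W (mesh_point t n k.+1) w - W (mesh_point t n k) w)) @[n --> \oo] -->
    X t w - (xbar + expR (- (kappa * t)) * (X 0 w - xbar)) /\
  sigma * (\sum_(0 <= k < n.+1) Psi kappa (t - mesh_point t n k) *
     (W (mesh_point t n k.+1) w - W (mesh_point t n k) w)) @[n --> \oo] -->
    J t w - (t * xbar + Psi kappa t * (X 0 w - xbar))}.
Proof.
move=> t0; have := vasicek_mesh_ae t0; apply: filterS => w Hw.
have rev (f f' : R -> R) : (forall u : R, is_derive u 1 f (f' u)) ->
    forall s : R, is_derive s 1 (fun s => f (t - s)) (- f' (t - s)).
  move=> df s; have H := is_derive_fun_comp (is_derive_fun_add
    (is_derive_fun_cst t s) (is_derive_fun_opp (is_derive_fun_id s))) (df (t - s)).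
  by apply: (is_derive_eq1 H); ring.
have Hw' n k : (k <= n)%N -> sigma * (W (mesh_point t n k.+1) w - W (mesh_point t n k) w) =
    X (Num.max 0 (mesh_point t n k.+1)) w - X (Num.max 0 (mesh_point t n k)) w -
    kappa * (xbar * mesh t n - (\int[mu]_(u in `[0, mesh_point t n k.+1]) X (Num.max 0 u) w -
      \int[mu]_(u in `[0, mesh_point t n k]) X (Num.max 0 u) w)).
  move=> _; rewrite !max_r ?mesh_point_ge0// -!(Rintegral_extend (X ^~ w)).
  exact: Hw.
have cexp : continuous (fun u => expR (- (kappa * u))).
  by apply: is_derive_continuous => u; exact: is_derive_decay.
have cPsi : continuous (Psi kappa).
  by apply: is_derive_continuous => u; exact: is_derive_Psi.
split.
- have dg (s : R) : is_derive s 1 (fun s => expR (- (kappa * (t - s))))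
      (kappa * expR (- (kappa * (t - s))) - 0).
    by apply: (is_derive_eq1 (rev _ _ (is_derive_decay kappa) s)); ring.
  have := wiener_sum_cvg t0 (@cX w) dg Hw'.
  rewrite (Rintegral_reversed t0 cexp (is_derive_Psi kappa) (Psi0 kappa)).
  rewrite (max_l (lexx 0)) max_r// subrr subr0 mulr0 oppr0 expR0 mul1r mul0r addr0.
  (* The drift contributes [kappa * xbar * Psi kappa t], that is [xbar * (1 - exp (- kappa t))]. *)
  congr (_ --> _); rewrite (decayE kappa t); ring.
- have dg (s : R) : is_derive s 1 (fun s => Psi kappa (t - s))
      (kappa * Psi kappa (t - s) - 1).
    by apply: (is_derive_eq1 (rev _ _ (is_derive_Psi kappa) s)); rewrite decayE; ring.
  have := wiener_sum_cvg t0 (@cX w) dg Hw'.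
  rewrite (Rintegral_reversed t0 cPsi (is_derive_Theta kappa) (Theta0 kappa)).
  rewrite (max_l (lexx 0)) max_r// subrr subr0 Psi0 mul0r mul1r -(Rintegral_extend (X ^~ w)).
  (* Here the drift contributes [kappa * xbar * Theta kappa t], that is
     [xbar * (t - Psi kappa t)]. *)
  congr (_ --> _); rewrite /J mulrAC ThetaE; ring.
Qed.

End vasicek.

End linear_sde.

(** * The conditional distribution *)

Section shifted_kernel.
Context {R : realType} d1 (T1 : measurableType d1) (n : nat).
Variables (mu : probability (n.-tuple R) R) (phi : T1 -> n.-tuple R).
Hypothesis mphi : measurable_fun setT phi.

(** As a map on pairs it is jointly measurable, and the measurability in [z] required of a kernel
    follows from that of sections. *)
Definition shift (zx : T1 * n.-tuple R) : n.-tuple R :=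
  [tuple tnth (phi zx.1) i + tnth zx.2 i | i < n].

Lemma measurable_shift : measurable_fun setT shift.
Proof.
apply/measurable_fun_tnthP => i.
rewrite (_ : _ \o _ = fun zx => tnth (phi zx.1) i + tnth zx.2 i); last first.
  by apply/funext => zx /=; rewrite tnth_mktuple.
apply: measurable_funD.
  apply: (measurableT_comp (@measurable_tnth _ R n i)).
  exact: (measurableT_comp mphi measurable_fst).
exact: (measurableT_comp (@measurable_tnth _ R n i) measurable_snd).
Qed.

Lemma measurable_shift_by z : measurable_fun setT (fun x => shift (z, x)).
Proof. exact: (measurableT_comp measurable_shift (pair1_measurable z)). Qed.

Definition shifted_law (z : T1) : {measure set (n.-tuple R) -> \bar R} :=
  law mu (measurable_shift_by z).

Lemma shifted_lawE z B : shifted_law z B = mu (xsection (shift @^-1` B) z).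
Proof. by congr (mu _); apply/seteqP; split => x /=; rewrite /xsection/= inE. Qed.

Lemma measurable_shift_preimage B : measurable B -> measurable (shift @^-1` B).
Proof. by move=> mB; rewrite -[X in measurable X]setTI; exact: measurable_shift. Qed.

Let measurable_shifted_law B : measurable B ->
  measurable_fun setT (shifted_law ^~ B).
Proof.
move=> mB; rewrite (_ : shifted_law ^~ B = mu \o xsection (shift @^-1` B)); last first.
  by apply/funext => z; exact: shifted_lawE.
exact: measurable_fun_xsection (measurable_shift_preimage mB).
Qed.

HB.instance Definition _ :=
  isKernel.Build _ _ _ _ R shifted_law measurable_shifted_law.

Let shifted_law_setT z : shifted_law z setT = 1%E.
Proof. exact: probability_setT. Qed.

HB.instance Definition _ :=
  Kernel_isProbability.Build _ _ _ _ R shifted_law shifted_law_setT.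

Definition shifted_kernel : R.-pker T1 ~> (n.-tuple R) := shifted_law.

End shifted_kernel.

Section conditional_law.
Context {R : realType} d d1 (T : measurableType d) (T1 : measurableType d1) (n : nat).
Variables (P : probability T R) (Z : T -> T1) (N Y : T -> n.-tuple R).
Variables (phi : T1 -> n.-tuple R).
Hypotheses (mZ : measurable_fun setT Z) (mN : measurable_fun setT N).
Hypothesis mphi : measurable_fun setT phi.
Hypothesis YE : forall w, Y w = shift phi (Z w, N w).
Hypothesis ZN : forall A B, measurable A -> measurable B ->
  P (Z @^-1` A `&` N @^-1` B) = (P (Z @^-1` A) * P (N @^-1` B))%E.

(** The pair [(Z, N)] has a product law, so the joint event is computed by integrating sections: at
    [z] in [A] the section is the set of [x] with [phi z + x] in [B], elsewhere it is empty. *)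
Lemma conditional_distribution_shifted :
  conditional_distribution P Y Z (shifted_kernel (law P mN) mphi).
Proof.
have mZN := measurable_fun_pair mZ mN.
have YE' : Y = shift phi \o (fun w => (Z w, N w)) by apply/funext => w; exact: YE.
split => //; first by rewrite YE'; exact: (measurableT_comp (measurable_shift mphi) mZN).
move=> A B mA mB; have mB' := measurable_shift_preimage mphi mB.
pose D := (A `*` setT) `&` shift phi @^-1` B.
have mD : measurable D by apply: measurableI => //; exact: measurableX.
have -> : Z @^-1` A `&` Y @^-1` B = (fun w => (Z w, N w)) @^-1` D.
  rewrite YE'; apply/seteqP; split => w; first by move=> [ZA YB].
  by move=> [[ZA _] YB].
rewrite (independent_product_law mZ mN ZN mD).
have mk : measurable_fun setT (fun z => law P mN (xsection (shift phi @^-1` B) z)).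
  exact: (measurable_fun_xsection (law P mN) mB').
transitivity (\int[law P mZ]_(z in A) law P mN (xsection (shift phi @^-1` B) z))%E.
  rewrite /product_measure1 [RHS]integral_mkcond; apply: eq_integral => z _ /=.
  rewrite patchE; case: ifPn => zA.
    congr (law P mN _); apply/seteqP; split => x; rewrite /xsection/= !inE.
      by case.
    by split => //; split => //; exact: set_mem.
  rewrite (_ : xsection D z = set0) ?measure0//.
  apply/seteqP; split => x //; rewrite /xsection/= inE => -[[/mem_set zA' _] _].
  by rewrite zA' in zA.
rewrite (ge0_integral_pushforward mZ P mA); last 2 first.
- exact: measurable_funTS.
- by move=> z _; exact: measure_ge0.
by apply: eq_integral => w _ /=; rewrite -shifted_lawE.
Qed.

End conditional_law.

(** * The covariance matrix as integrals of products of responses *)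

Section covariance.
Context {R : realType}.
Variables (kappa alpha beta sr sx sp rho_rS rho_rpi rho_Spi t : R).

(* Coordinate i of N is weight_i * int_0^t response_i (t - s) dW^(driver_i)_s,
   with the drivers numbered as in corr_mx: r, S, pi. *)
Definition weight : 7.-tuple R := [tuple sr; sr; - sx; - sx; sp; sp; 1].

Definition driver : 7.-tuple 'I_3 :=
  [tuple inord 0; inord 0; inord 1; inord 1; inord 2; inord 2; inord 1].

Definition response : 7.-tuple (R -> R) :=
  [tuple fun u => expR (- (kappa * u)); Psi kappa; fun u => expR (- (alpha * u));
         Psi alpha; fun u => expR (- (beta * u)); Psi beta; fun=> 1].

Lemma continuous_response i : continuous (tnth response i).
Proof.
have ce k : continuous (fun u : R => expR (- (k * u))).
  by apply: is_derive_continuous => u; exact: is_derive_decay.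
have cP (k : R) : continuous (Psi k).
  by apply: is_derive_continuous => u; exact: is_derive_Psi.
by case: i => [[|[|[|[|[|[|[|]]]]]]] i7] //; rewrite (tnth_nth (fun=> 0))/=;
  do ?[exact: ce|exact: cP|exact: cst_continuous].
Qed.

(* Entry (i, j), for j <= i, is the primitive of response_i * response_j
   vanishing at 0; the layout follows cov_mx. *)
Definition response_primitive : seq (seq (R -> R)) :=
  [:: [:: Psi (2 * kappa)];
      [:: Gamma kappa kappa; Upsilon kappa];
      [:: Psi (kappa + alpha); Gamma kappa alpha; Psi (2 * alpha)];
      [:: Gamma alpha kappa; Lambda kappa alpha; Gamma alpha alpha; Upsilon alpha];
      [:: Psi (kappa + beta); Gamma kappa beta; Psi (alpha + beta); Gamma alpha beta;
          Psi (2 * beta)];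
      [:: Gamma beta kappa; Lambda kappa beta; Gamma beta alpha; Lambda alpha beta;
          Gamma beta beta; Upsilon beta];
      [:: Psi kappa; Theta kappa; Psi alpha; Theta alpha; Psi beta; Theta beta; id]].

Lemma is_derive_Psi2 (k u : R) : is_derive u 1 (Psi (2 * k)) (expR (- (k * u)) * expR (- (k * u))).
Proof. by rewrite (_ : 2 * k = k + k); [exact: is_derive_PsiD|ring]. Qed.

Lemma is_derive_response_primitive (i j : 'I_7) (u : R) : (j <= i)%N ->
  is_derive u 1 (nth (fun=> 0) (nth [::] response_primitive i) j)
    (tnth response i u * tnth response j u).
Proof.
rewrite !(tnth_nth (fun=> 0)).
case: i => [[|[|[|[|[|[|[|]]]]]]] i7] //; case: j => [[|[|[|[|[|[|[|]]]]]]] j7] //= _.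
all: first [ exact: is_derive_Psi2 | exact: is_derive_PsiD | exact: is_derive_Gamma
  | exact: is_derive_Lambda | exact: is_derive_Upsilon
  | by rewrite mulrC; exact: is_derive_PsiD
  | by rewrite mulrC; exact: is_derive_Gamma
  | by rewrite mulrC; exact: is_derive_Lambda
  | by rewrite mul1r; exact: is_derive_Psi
  | by rewrite mul1r; exact: is_derive_Theta
  | by rewrite mul1r; exact: is_derive_fun_id].
Qed.

Lemma response_primitive0 (i j : 'I_7) : (j <= i)%N ->
  nth (fun=> 0) (nth [::] response_primitive i) j 0 = 0 :> R.
Proof.
case: i => [[|[|[|[|[|[|[|]]]]]]] i7] //; case: j => [[|[|[|[|[|[|[|]]]]]]] j7] //= _.
all: by rewrite ?(Psi0, Theta0, Upsilon0, Gamma0, Lambda0).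
Qed.

Local Notation corr := (corr_mx rho_rS rho_rpi rho_Spi).

Lemma corr_mxC i j : corr i j = corr j i.
Proof.
by rewrite !mxE; case: i => [[|[|[|]]] i3] //; case: j => [[|[|[|]]] j3].
Qed.

(** Reversing time turns the integral into the tabulated primitive at [t]; signs come from the
    weight [- sx], and coordinates with a common driver have correlation 1. *)
Lemma cov_mxE (i j : 'I_7) : 0 <= t ->
  cov_mx kappa alpha beta sr sx sp rho_rS rho_rpi rho_Spi t i j =
  tnth weight i * tnth weight j * corr (tnth driver j) (tnth driver i) *
    \int[lebesgue_measure]_(s in `[0, t]) (tnth response i (t - s) * tnth response j (t - s)).
Proof.
move=> t0; wlog ji : i j / (j <= i)%N.
  move=> H; have [/H//|/ltnW ij] := leqP j i.
  transitivity (cov_mx kappa alpha beta sr sx sp rho_rS rho_rpi rho_Spi t j i).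
    by rewrite !mxE maxnC minnC.
  rewrite (H j i ij) corr_mxC [tnth weight j * _]mulrC; congr (_ * _).
  by apply: eq_Rintegral => s _; rewrite mulrC.
have cij : continuous (fun u => tnth response i u * tnth response j u).
  by move=> u; apply: cvgM; exact: continuous_response.
rewrite (@Rintegral_reversed R _ _ t t0 cij (fun u => is_derive_response_primitive u ji)
  (response_primitive0 ji)).
rewrite mxE (maxn_idPl ji) (minn_idPr ji) mxE !(tnth_nth 0).
case: i ji {cij} => [[|[|[|[|[|[|[|]]]]]]] i7] //;
  case: j => [[|[|[|[|[|[|[|]]]]]]] j7] //= _; rewrite !inordK//=; ring.
Qed.

End covariance.

Section driving_motion.
Context {R : realType} d (T : measurableType d).
Variables (P : probability T R) (F : R -> set (set T)).

(** Joint Gaussianity is inherited by dropping the last coordinate, which receives coefficient 0. *)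
Lemma gaussian_process_widen n (W : R -> T -> n.-tuple R) (W' : R -> T -> n.+1.-tuple R) :
  (forall s w (i : 'I_n), tnth (W' s w) (widen_ord (leqnSn n) i) = tnth (W s w) i) ->
  gaussian_process P W' -> gaussian_process P W.
Proof.
move=> WE hG k s c s0.
pose c' (j : 'I_k) (i : 'I_n.+1) := if unlift ord_max i is Some i' then c j i' else 0.
have [m [v H]] := hG k s c' s0; exists m, v.
rewrite (_ : (fun w => _) = fun w => \sum_j \sum_i c' j i * tnth (W' (s j) w) i)//.
apply/funext => w; apply: eq_bigr => j _; rewrite big_ord_recr/=.
rewrite {2}/c' unlift_none mul0r addr0; apply: eq_bigr => i _.
rewrite /c' -WE (_ : widen_ord _ i = lift ord_max i) ?liftK//.
by apply/val_inj; rewrite /= /bump leqNgt ltn_ord.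
Qed.

Lemma measurable_coordinate n (C : 'M[R]_n) (W : R -> T -> n.-tuple R) (i : 'I_n) s :
  filtration F -> brownian_motion P F C W -> 0 <= s ->
  measurable_fun setT (fun w => tnth (W s w) i).
Proof.
move=> hF hW s0; apply: (measurableT_comp (@measurable_tnth _ R n i)).
apply: (measurable_of_sub hF s0).
exact: (adapted_sub hF hW s0 (lexx s)).
Qed.

End driving_motion.

Theorem proposition4p1 (R : realType) (d : measure_display)
  (Omega : measurableType d) (P : probability Omega R)
  (F : R -> set (set Omega))
  (kappa alpha beta rbar xbar pibar : R)
  (sigma_r sigma_S sigma_x sigma_I sigma_pi : R)
  (rho_rS rho_rpi rho_Spi : R)
  (Wr WS Wpi WI : R -> Omega -> R)
  (r S x I pi : R -> Omega -> R)
  (hF : filtration F)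
  (hsigma_r : 0 <= sigma_r) (hsigma_S : 0 <= sigma_S) (hsigma_x : 0 <= sigma_x)
  (hsigma_I : 0 <= sigma_I) (hsigma_pi : 0 <= sigma_pi)
  (hrho : possemidef (corr_mx rho_rS rho_rpi rho_Spi))
  (hW : brownian_motion P F (corr_mx rho_rS rho_rpi rho_Spi)
          (fun t w => [tuple Wr t w; WS t w; Wpi t w]))
  (hWI : brownian_motion P F (1%:M : 'M[R]_1) (fun t w => [tuple WI t w]))
  (hgauss : gaussian_process P
          (fun t w => [tuple Wr t w; WS t w; Wpi t w; WI t w]))
  (hindep : independent_systems P (process_sigma WI)
          (process_sigma (fun t w => [tuple Wr t w; WS t w; Wpi t w])))
  (hr : sde_solution P F r
          (fun t w => kappa * (rbar - r t w)) (fun _ _ => sigma_r) Wr)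
  (hS : sde_solution P F S
          (fun t w => (r t w + x t w) * S t w) (fun t w => sigma_S * S t w) WS)
  (hx : sde_solution P F x
          (fun t w => alpha * (xbar - x t w)) (fun _ _ => - sigma_x) WS)
  (hI : sde_solution P F I
          (fun t w => pi t w * I t w) (fun t w => sigma_I * I t w) WI)
  (hpi : sde_solution P F pi
          (fun t w => beta * (pibar - pi t w)) (fun _ _ => sigma_pi) Wpi)
  (t : R) (ht : 0 <= t) :
  let Y : Omega -> 7.-tuple R := fun w =>
    [tuple r t w; \int[lebesgue_measure]_(s in `[0, t]) r s w;
           x t w; \int[lebesgue_measure]_(s in `[0, t]) x s w;
           pi t w; \int[lebesgue_measure]_(s in `[0, t]) pi s w;
           WS t w] in
  let Z : Omega -> 5.-tuple R := fun w =>
    [tuple r 0 w; S 0 w; x 0 w; I 0 w; pi 0 w] in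
  exists k : R.-pker (5.-tuple R) ~> (7.-tuple R),
    conditional_distribution P Y Z k /\
    forall r0 S0 x0 I0 pi0 : R,
      multinormal_law (k [tuple r0; S0; x0; I0; pi0])
        (mean_vec kappa alpha beta rbar xbar pibar t r0 x0 pi0)
        (cov_mx kappa alpha beta sigma_r sigma_x sigma_pi
                rho_rS rho_rpi rho_Spi t).
Proof.
move=> Y Z.
pose W3 s w := [tuple Wr s w; WS s w; Wpi s w] : 3.-tuple R.
have hG : gaussian_process P W3.
  apply: (gaussian_process_widen _ hgauss) => s w i.
  by rewrite !(tnth_nth 0); case: i => [[|[|[|]]] i3].
have mWr s (s0 : 0 <= s) : measurable_fun setT (Wr s).
  have := measurable_coordinate (inord 0) hF hW s0; congr measurable_fun.
  by apply/funext => w; rewrite (tnth_nth 0)/= inordK.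
have mWS s (s0 : 0 <= s) : measurable_fun setT (WS s).
  have := measurable_coordinate (inord 1) hF hW s0; congr measurable_fun.
  by apply/funext => w; rewrite (tnth_nth 0)/= inordK.
have mWpi s (s0 : 0 <= s) : measurable_fun setT (Wpi s).
  have := measurable_coordinate (inord 2) hF hW s0; congr measurable_fun.
  by apply/funext => w; rewrite (tnth_nth 0)/= inordK.
have mY : measurable_fun setT Y.
  apply/measurable_fun_tnthP => i; rewrite /comp.
  case: i => [[|[|[|[|[|[|[|]]]]]]] i7] //.
  - exact: (measurable_sde_solution hF hr).
  - exact: (measurable_sde_integral hF hr).
  - exact: (measurable_sde_solution hF hx).
  - exact: (measurable_sde_integral hF hx).
  - exact: (measurable_sde_solution hF hpi).
  - exact: (measurable_sde_integral hF hpi).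
  - exact: mWS.
have sF0 : sigma_algebra setT (F 0) by case: hF => H _ _; exact: H.
(* Adaptedness at time 0 puts the initial vector in [F 0], of which [N] will be independent. *)
have mZ0 : @measurable_fun _ _ (g_sigma_algebraType (F 0)) (5.-tuple R) setT Z.
  have m0 X a b W : sde_solution P F X a b W ->
      @measurable_fun _ _ (g_sigma_algebraType (F 0)) R setT (X 0).
    by move=> [aX _ _]; apply/(measurable_fun_subP sF0); exact: aX.
  apply/measurable_fun_tnthP => i; rewrite /comp.
  case: i => [[|[|[|[|[|]]]]] i5] //.
  - exact: m0 hr.
  - exact: m0 hS.
  - exact: m0 hx.
  - exact: m0 hI.
  - exact: m0 hpi.
have mZ : measurable_fun setT Z := measurable_of_sub hF (lexx 0) mZ0.
(* Positions 0, 2 and 4 of the initial vector hold [r], [x] and [pi]. *)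
pose phi (z : 5.-tuple R) := mean_vec kappa alpha beta rbar xbar pibar t
  (nth 0 z 0) (nth 0 z 2) (nth 0 z 4).
have mphi : measurable_fun setT phi.
  have mnth k : (k < 5)%N -> measurable_fun setT (fun z : 5.-tuple R => nth 0 z k).
    move=> k5; have := @measurable_tnth _ R 5 (Ordinal k5); congr measurable_fun.
    by apply/funext => z; rewrite (tnth_nth 0).
  have maff k (a b c : R) : (k < 5)%N ->
      measurable_fun setT (fun z : 5.-tuple R => a + b * (nth 0 z k - c)).
    move=> k5; apply: measurable_funD => //; apply: measurable_funM => //.
    by apply: measurable_funB => //; exact: mnth.
  apply/measurable_fun_tnthP => i; rewrite /comp.
  case: i => [[|[|[|[|[|[|[|]]]]]]] i7] //; first [exact: maff|exact: measurable_cst].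
pose N w := [tuple tnth (Y w) i - tnth (phi (Z w)) i | i < 7].
have mN : measurable_fun setT N.
  apply/measurable_fun_tnthP => i.
  rewrite (_ : _ \o _ = fun w => tnth (Y w) i - tnth (phi (Z w)) i); last first.
    by apply/funext => w /=; rewrite tnth_mktuple.
  apply: measurable_funB; apply: (measurableT_comp (@measurable_tnth _ R 7 i)) => //.
  exact: measurableT_comp.
have YE w : Y w = shift phi (Z w, N w).
  by apply: eq_from_tnth => i; rewrite !tnth_mktuple addrC subrK.
pose g (i : 'I_7) (s : R) := tnth (response kappa alpha beta) i (t - s).
pose b := tnth (weight sigma_r sigma_x sigma_pi).
pose c := tnth driver.
have cg i : continuous (g i).
  move=> s; apply: (@continuous_comp _ _ _ (fun s : R => t - s)
    (tnth (response kappa alpha beta) i)); last exact: continuous_response.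
  by apply: cvgB; [exact: cvg_cst|exact: cvg_id].
have cV : {ae P, forall w, forall i,
    tnth (increment_sum W3 (mesh_point t n) (fun i k => b i * g i (mesh_point t n k))
      c n.+1 w) i @[n --> \oo] --> tnth (N w) i}.
  (* The seventh coordinate is [WS t] itself, whereas its sums telescope to [WS t - WS 0]. *)
  have W0 : {ae P, forall w, WS 0 w = 0}.
    case: hW => _ + _ _ _; apply: filterS => w /(_ (inord 1)).
    by rewrite (tnth_nth 0)/= inordK.
  have Hr := vasicek_cvg hF hr mWr ht.
  have Hx := vasicek_cvg hF hx mWS ht.
  have Hpi := vasicek_cvg hF hpi mWpi ht.
  apply: filterS2 (filterI W0 Hr) (filterI Hx Hpi) => w [{}W0 [r1 r2]] [[x1 x2] [p1 p2]] i.
  have E n : tnth (increment_sum W3 (mesh_point t n) (fun i k => b i * g i (mesh_point t n k))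
      c n.+1 w) i = b i * \sum_(0 <= k < n.+1) g i (mesh_point t n k) *
        (tnth (W3 (mesh_point t n k.+1) w) (c i) - tnth (W3 (mesh_point t n k) w) (c i)).
    rewrite tnth_mktuple mulr_sumr; apply: eq_bigr => k _.
    by rewrite tnth_mktuple mulrA.
  under eq_fun do rewrite E.
  rewrite tnth_mktuple {E} /b /g /c.
  have tnth3 s (k : nat) : (k < 3)%N ->
      tnth (W3 s w) (inord k) = nth 0 [:: Wr s w; WS s w; Wpi s w] k.
    by move=> k3; rewrite (tnth_nth 0) inordK.
  have same (a : R) (G : R -> R) k (l : R) (U : R -> R) : (k < 3)%N ->
      (forall s, nth 0 [:: Wr s w; WS s w; Wpi s w] k = U s) ->
      a * \sum_(0 <= j < n.+1) G (t - mesh_point t n j) *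
        (U (mesh_point t n j.+1) - U (mesh_point t n j)) @[n --> \oo] --> l ->
      a * \sum_(0 <= j < n.+1) G (t - mesh_point t n j) *
        (tnth (W3 (mesh_point t n j.+1) w) (inord k) -
         tnth (W3 (mesh_point t n j) w) (inord k)) @[n --> \oo] --> l.
    move=> k3 UE; apply: cvg_trans; apply: near_eq_cvg; apply: nearW => n.
    by congr (_ * _); apply: eq_bigr => j _; rewrite !tnth3// !UE.
  case: i => [[|[|[|[|[|[|[|//]]]]]]] i7]; rewrite !(tnth_nth 0) /=.
  - exact: (same _ (fun u => expR (- (kappa * u))) 0%N _ (Wr ^~ w)) r1.
  - exact: (same _ (Psi kappa) 0%N _ (Wr ^~ w)) r2.
  - exact: (same _ (fun u => expR (- (alpha * u))) 1%N _ (WS ^~ w)) x1.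
  - exact: (same _ (Psi alpha) 1%N _ (WS ^~ w)) x2.
  - exact: (same _ (fun u => expR (- (beta * u))) 2%N _ (Wpi ^~ w)) p1.
  - exact: (same _ (Psi beta) 2%N _ (Wpi ^~ w)) p2.
  - apply: (same 1 (fun=> 1) 1%N _ (WS ^~ w)) => //.
    apply: cvg_near_cst; apply: nearW => n; rewrite mul1r.
    under eq_bigr do rewrite mul1r.
    rewrite (@telescope_sumr _ 0%N n.+1 (fun k => WS (mesh_point t n k) w))//.
    by rewrite mesh_pointT mesh_point0 W0.
have ZN A B : measurable A -> measurable B ->
    P (Z @^-1` A `&` N @^-1` B) = (P (Z @^-1` A) * P (N @^-1` B))%E.
  move=> mA mB; have FA : F 0 (Z @^-1` A).
    move/(measurable_fun_subP sF0) : mZ0; apply.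
    by exists A => //; rewrite setTI.
  exact: (wiener_integral_independent hF hW ht mN cV FA mB).
exists (shifted_kernel (law P mN) mphi); split.
  exact: (conditional_distribution_shifted mZ mN mphi YE ZN).
move=> r0 S0 x0 I0 pi0; split.
  by apply/matrixP => i j; rewrite !mxE maxnC minnC.
move=> u; set z := [tuple r0; S0; x0; I0; pi0].
have := normal_law_shift (\sum_i u 0 i * tnth (phi z) i)
  (wiener_integral_normal hF hW hG ht cg mN cV u).
(* For fixed [z], a linear functional under the kernel is the constant [u] applied to [phi z] plus
   the centred normal variable [u] applied to [N]. *)
rewrite (_ : pushforward P _ = pushforward (shifted_kernel (law P mN) mphi z)
  (fun x : 7.-tuple R => \sum_i u 0 i * tnth x i)); last first.
  apply/funext => A; congr (P _); apply/seteqP.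
  have E w : \sum_i u 0 i * tnth (shift phi (z, N w)) i =
      \sum_i u 0 i * tnth (phi z) i + \sum_i u 0 i * tnth (N w) i.
    by rewrite -big_split/=; apply: eq_bigr => i _; rewrite tnth_mktuple mulrDr.
  by split => w /=; rewrite E.
congr normal_law; rewrite mxE exchange_big/=; apply: eq_bigr => j _.
rewrite [(u *m _) 0 j]mxE [u^T _ _]mxE mulr_suml; apply: eq_bigr => i _.
rewrite (cov_mxE _ _ _ _ _ _ _ _ _ _ _ ht) /b /c /g.
by ring.
Qed.
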